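(* The function $r\mapsto\frac1rV^\infty_{r^2}$ is nonincreasing and convex on $(0,\infty)$. In particular, $T\mapsto V_T^\infty$ is continuous (on $(0,\infty)$).
   Context: For $T>0$, on a probability space hosting a one-dimensional standard Brownian motion $B=(B(t))_{0\le t\le T}$, define $$V_T^\infty=\inf\Big\{\Big\|\int_0^T\alpha(t)\,dt+B(T)\Big\|_\infty:\ \|\alpha(t)\|_2\le\sqrt{2/\pi}\ \text{ for all }t\in[0,T]\Big\},$$ where the infimum is over real-valued processes $\alpha$ progressively measurable with respect to the filtration of $B$ satisfying the displayed constraint. Here $\|X\|_2=\mathbb{E}[X^2]^{1/2}$ and $\|X\|_\infty=\operatorname{ess\,sup}|X|$. *)

(* Defs.v *)
From mathcomp Require Import all_boot all_order all_algebra.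
From mathcomp Require Import all_classical all_reals all_analysis.

Set Implicit Arguments.
Unset Strict Implicit.
Unset Printing Implicit Defensive.

Import Order.TTheory GRing.Theory Num.Theory.
Import numFieldNormedType.Exports.

Local Open Scope classical_set_scope.
Local Open Scope ring_scope.

Section brownian.
Context {R : realType} {d : measure_display} {Omega : measurableType d}.

(* Processes are indexed by R, but only times in [0, T] matter below. *)
Implicit Types (B alpha : R -> Omega -> R) (T t : R).

(* The natural filtration of B is t |-> <<s natural_gen B t >>; it is not
   completed by the null sets. *)
Definition natural_gen B t : set (set Omega) :=
  \bigcup_(s in `[0, t]) preimage_set_system [set: Omega] (B s) measurable.

Definition increment B (s t : R) : Omega -> R := fun w => B t w - B s w.

Record brownian_motion (P : probability Omega R) T B : Prop := {
  brownian_measurable :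
    forall t : R, 0 <= t -> t <= T -> measurable_fun [set: Omega] (B t) ;
  brownian_start : \forall w \ae P, B 0 w = 0 ;
  brownian_continuous :
    \forall w \ae P, {within `[0, T], continuous (fun t => B t w)} ;
  brownian_indep_incr : forall s t : R, 0 <= s -> s <= t -> t <= T ->
    forall (A : set Omega) (U : set R),
      <<s natural_gen B s >> A -> measurable U ->
      P (A `&` increment B s t @^-1` U) = (P A * P (increment B s t @^-1` U))%E ;
  (* the second parameter of normal_prob is the standard deviation *)
  brownian_normal_incr : forall s t : R, 0 <= s -> s < t -> t <= T ->
    forall U : set R, measurable U ->
      P (increment B s t @^-1` U) = normal_prob 0 (Num.sqrt (t - s)) U }.

(* For each t in [0, T], (s, w) |-> alpha s w is measurable on [0, t] x Omega
   for the product of the Borel sets and <<s natural_gen B t >>. *)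
Definition progressively_measurable T B alpha : Prop :=
  forall t : R, 0 <= t -> t <= T ->
    measurable_fun (`[0, t] `*` [set: g_sigma_algebraType (natural_gen B t)])
      (fun x : R * g_sigma_algebraType (natural_gen B t) => alpha x.1 x.2).

Definition admissible (P : probability Omega R) T B : set (R -> Omega -> R) :=
  [set alpha | progressively_measurable T B alpha /\
    forall t : R, 0 <= t -> t <= T ->
      ('N[P]_2%:E [EFin \o alpha t] <= (Num.sqrt (2 / pi))%:E)%E].

(* For admissible alpha, almost every path t |-> alpha t w is integrable on
   [0, T] by Fubini, so that the value of Rintegral on non-integrable paths does
   not affect the essential supremum. *)
Definition terminal_value T B alpha : Omega -> R :=
  fun w => (\int[lebesgue_measure]_(t in `[0, T]) alpha t w) + B T w.

Definition Vinfty (P : probability Omega R) B T : \bar R :=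
  ereal_inf [set ('N[P]_+oo [EFin \o terminal_value T B alpha])%E
            | alpha in admissible P T B].

End brownian.

(* Main.v *)
Require Import Defs.
From mathcomp Require Import all_boot all_order all_algebra.
From mathcomp Require Import all_classical all_reals all_analysis.
From mathcomp Require Import measurable_realfun ess_sup_inf ring lra.
Import Order.TTheory GRing.Theory Num.Theory.
Import numFieldNormedType.Exports.
Local Open Scope classical_set_scope.
Local Open Scope ring_scope.

(* Let V(T, k) be the value of the problem with sqrt(2/pi) replaced by k. On a
   fixed probability space V(T, .) is convex, by taking convex combinations of
   controls. By Brownian scaling V(r^2, c)/r should only depend on the product
   r c, which gives both claims, but the spaces and the natural filtrations
   differ from one r to another, so that controls have to be transported from
   one Brownian motion to another one. A progressively measurable control is,
   on [0, q], a jointly measurable functional of time and of the Brownian path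
   up to q; running it with a small delay which vanishes at the terminal time
   makes this representation progressive, hence transportable, at the price of
   multiplying the bound k by a factor arbitrarily close to 1. That loss is
   absorbed by the convexity of V(T, .), which is finite: on the grid
   t_k = T (1 - 16^-k) each control compensates, during the next interval, the
   part of the previous Brownian increment exceeding a summable threshold. *)

Set Implicit Arguments.
Unset Strict Implicit.
Unset Printing Implicit Defensive.

(** * Scaling and affine substitution in integrals that may fail to exist *)

(** The case [x = y = +oo] is included: the convention gives [+oo - +oo] the value [-oo], which
    multiplication by a positive real preserves. Hence the integral identities below hold without
    integrability. *)
Lemma pmule_ge0B {R : realType} (a : R) (x y : \bar R) :
  0 < a -> (0 <= x)%E -> (0 <= y)%E -> (a%:E * (x - y) = a%:E * x - a%:E * y)%E.
Proof.
move=> a0 x0 y0.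
have ay : (a%:E * +oo = +oo)%E by rewrite gt0_muley// lte_fin.
have aNy : (a%:E * -oo = -oo)%E by rewrite gt0_muleNy// lte_fin.
case: x x0 => [x| |] // x0; case: y y0 => [y| |] // y0.
- by rewrite muleBr.
- by rewrite ay /= aNy.
- by rewrite addye// ay addye.
- by rewrite ay /= aNy.
Qed.

Lemma integral_pZl {R : realType} {d} {X : measurableType d}
    (mu : {measure set X -> \bar R}) (a : R) (D : set X) (f : X -> \bar R) :
  0 < a -> measurable D -> measurable_fun D f ->
  (\int[mu]_(x in D) (a%:E * f x) = a%:E * \int[mu]_(x in D) f x)%E.
Proof.
move=> a0 mD mf; rewrite integralE [in RHS]integralE.
rewrite pmule_ge0B ?integral_ge0//.
rewrite -!ge0_integralZl_EFin ?ltW//; last 2 first.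
- exact: measurable_funeneg.
- exact: measurable_funepos.
congr (_ - _)%E; apply: eq_integral => x _.
  by rewrite !funeposE maxe_pMr ?mule0// lee_fin ltW.
by rewrite !funenegE maxe_pMr ?mule0 ?muleN// lee_fin ltW.
Qed.

Section affine_substitution.
Context {R : realType}.
Variables (a b : R).
Hypothesis a0 : 0 < a.
Let mu := @lebesgue_measure R.
Let phi : measurableTypeR R -> measurableTypeR R := fun y => a * y + b.

Let mphi : measurable_fun setT phi.
Proof. by apply: measurable_funD => //; exact: measurable_funM. Qed.

Let nu : {measure set (measurableTypeR R) -> \bar R}.
Proof. by apply: (mscale (NngNum (ltW a0)) (pushforward mu phi));
  exact: mphi. Defined.

(** The preimage of []x, y]] under [phi] has length (y - x) / a, and the factor a in [nu] restores y
    - x; half-open intervals characterize Lebesgue measure. *)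
Let lebesgue_affine (A : set R) : measurable A -> mu A = nu A.
Proof.
move=> mA; apply: lebesgue_measure_unique => // _ [[x y]] _ <-.
rewrite /nu /= /mscale /= /pushforward.
have -> : phi @^-1` `]x, y]%classic = `](x - b) / a, (y - b) / a]%classic.
  apply/seteqP; split => z /=; rewrite !in_itv /= /phi.
    by rewrite ltr_pdivrMr// ler_pdivlMr// ltrBlDr lerBrDr mulrC.
  by rewrite ltr_pdivrMr// ler_pdivlMr// ltrBlDr lerBrDr mulrC.
rewrite !lebesgue_measure_itv /= !lte_fin.
rewrite ltr_pM2r ?invr_gt0// ltrD2r.
case: ifPn => _; last by rewrite mule0.
rewrite -!EFinB -EFinM; congr (_%:E);
  rewrite -mulrBl opprB addrA subrK mulrCA divff ?mulr1 ?gt_eqF//.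
Qed.

Lemma ge0_integral_affine (D : set R) (f : R -> \bar R) :
  measurable D -> measurable_fun D f -> {in D, forall x, (0 <= f x)%E} ->
  (\int[mu]_(x in D) f x =
   a%:E * \int[mu]_(y in (fun y => a * y + b)%R @^-1` D) f (a * y + b)%R)%E.
Proof.
move=> mD mf f0.
have -> : (a%:E * \int[mu]_(y in phi @^-1` D) (f \o phi) y =
           \int[nu]_(x in D) f x)%E.
  rewrite -(ge0_integral_pushforward mphi)//.
  rewrite /nu ge0_integral_mscale// => x Dx; apply: f0; rewrite inE.
  exact: Dx.
by apply: eq_measure_integral => A mA _; exact: lebesgue_affine.
Qed.

Lemma integral_affine (D : set R) (f : R -> \bar R) :
  measurable D -> measurable_fun D f ->
  (\int[mu]_(x in D) f x =
   a%:E * \int[mu]_(y in (fun y => a * y + b)%R @^-1` D) f (a * y + b)%R)%E.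
Proof.
move=> mD mf; rewrite integralE [in RHS]integralE.
rewrite (ge0_integral_affine mD (measurable_funepos mf))//.
rewrite (ge0_integral_affine mD (measurable_funeneg mf))//.
have E1 : ((fun y => f (a * y + b)%R)^\+ = (fun y =>
  f^\+ (a * y + b)%R))%E by apply/funext => y; rewrite !funeposE.
have E2 : ((fun y => f (a * y + b)%R)^\- = (fun y =>
  f^\- (a * y + b)%R))%E by apply/funext => y; rewrite !funenegE.
rewrite E1 E2; clear E1 E2.
set x := integral _ _ _; set y := integral _ _ _.
have x0 : (0 <= x)%E by exact: integral_ge0.
have y0 : (0 <= y)%E by exact: integral_ge0.
by rewrite (pmule_ge0B a0 x0 y0).
Qed.

End affine_substitution.

(** * Doob-Dynkin factorization through a map *)

Section doob_dynkin.
Context {R : realType} {d1 d2 : measure_display}.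
Context {Z1 : measurableType d1} {Z2 : measurableType d2}.

(** For each rational q, the part of D where f < q is the preimage under h of some measurable [C q];
    the factor g is the infimum of the rationals q with x in [C q]. *)
Lemma measurable_factor (h : Z1 -> Z2) (D : set Z1) (f : Z1 -> R) :
  measurable D ->
  (forall A, measurable A -> exists2 C, measurable C & A = h @^-1` C) ->
  measurable_fun D f ->
  exists2 g : Z2 -> R, measurable_fun setT g & forall z, D z -> f z = g (h z).
Proof.
move=> mD hA mf.
have hC (q : rat) : {C : set Z2 | measurable C /\
    D `&` f @^-1` `]-oo, ratr q[ = h @^-1` C}.
  apply: cid; have [|C mC DC] := hA (D `&` f @^-1` `]-oo, ratr q[).
    exact: mf.
  by exists C.
pose C q := sval (hC q).
have mC q : measurable (C q) by case: (svalP (hC q)).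
have CE q z : D z -> C q (h z) <-> f z < ratr q.
  move=> Dz; have [_ CE] := svalP (hC q).
  change (C q (h z)) with ((h @^-1` C q) z).
  rewrite /C -CE /= in_itv /=; split; first by case.
  by move=> ?; split.
pose q_ n : rat := odflt 0 (unpickle n).
pose u n (x : Z2) : \bar R := if x \in C (q_ n) then (ratr (q_ n))%:E else +oo%E.
(* Away from the image of D the infimum may be infinite; [fine] then returns 0, which is harmless
   since g is tested only on h z with z in D. *)
exists (fun x => fine (einfs (u ^~ x) 0%N)).
  apply: measurableT_comp => //.
  apply: measurable_fun_einfs => n.
  apply: measurable_fun_ifT => //.
  apply: (measurable_fun_bool true).
  rewrite setTI (_ : _ @^-1` _ = C (q_ n)) //.
  by apply/seteqP; split => x /=; [move/set_mem|move/mem_set].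
move=> z Dz; rewrite (_ : einfs _ _ = (f z)%:E)//.
apply/eqP; rewrite eq_le; apply/andP; split.
  apply/lee_addgt0Pr => e e0.
  have [q] := @rat_in_itvoo R (f z) (f z + e) (ltac:(by rewrite ltrDl)).
  rewrite in_itv /= => /andP[fq qe].
  rewrite (@le_trans _ _ (ratr q)%:E)//; last by rewrite -EFinD lee_fin ltW.
  apply: ereal_inf_lbound => /=; exists (pickle q) => //=.
  by rewrite /u /q_ pickleK /= mem_set//; exact/CE.
apply: le_ereal_inf_tmp => _ [n _ <-]; rewrite /u; case: ifPn => [/set_mem /CE|_].
  by move=> /(_ Dz)/ltW; rewrite lee_fin.
by rewrite leey.
Qed.

End doob_dynkin.

(** * Progressive processes as functionals of time and of the Brownian path *)

Section path.
Context {R : realType}.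

(** Path space is the set of all functions, without continuity: only finite-dimensional marginals
    are compared on it. *)
Definition coord_gen (t : R) : set (set (R -> R)) :=
  \bigcup_(s in `[0, t]) preimage_set_system setT (fun x => x s) measurable.

Context {d : measure_display} {Omega : measurableType d}.
Implicit Type B : R -> Omega -> R.

Definition path_of B : Omega -> R -> R := fun w t => B t w.

Lemma natural_genE B t :
  natural_gen B t = preimage_set_system setT (path_of B) (coord_gen t).
Proof.
apply/seteqP; split => [A [s st [U mU <-]]|_ [_ [s st [U mU <-]] <-]].
  exists ((fun x => x s) @^-1` U); last by [].
  exists s => //; by exists U => //; rewrite setTI.
by rewrite !setTI; exists s => //; exists U => //; rewrite setTI.
Qed.

Lemma natural_sigmaE B t :
  <<s natural_gen B t >> =
  preimage_set_system setT (path_of B) (<<s coord_gen t >>).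
Proof. by rewrite natural_genE g_sigma_preimageE. Qed.

(** The natural filtration is pulled back from path space by [path_of B], so the product with the
    Borel sets of time is pulled back by the product map. This is the hypothesis that
    [measurable_factor] asks for. *)
Lemma prod_natural_sigma B t
    (A : set (R * g_sigma_algebraType (natural_gen B t))) : measurable A ->
  exists2 C : set (R * g_sigma_algebraType (coord_gen t)),
    measurable C & A = (fun z => (z.1, path_of B z.2)) @^-1` C.
Proof.
pose g (z : R * g_sigma_algebraType (natural_gen B t)) :
  R * g_sigma_algebraType (coord_gen t) := (z.1, path_of B z.2).
have := g_sigma_preimageU_comp (@fst R (g_sigma_algebraType (coord_gen t)))
    (@snd R (g_sigma_algebraType (coord_gen t))) g.
rewrite /g_sigma_preimageU.
rewrite (_ : preimage_set_system setT (snd \o g) measurable =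
  preimage_set_system setT (@snd R (g_sigma_algebraType (natural_gen B t)))
    measurable).
  move=> E mA.
  have [C mC CA] : preimage_set_system setT g measurable A
    by rewrite /measurable /= -E.
  by exists C => //; rewrite -CA setTI.
rewrite (_ : snd \o g = path_of B \o snd)// preimage_set_system_comp.
by congr (preimage_set_system _ _ _); rewrite [RHS]natural_sigmaE.
Qed.

(** The functional is tied to the horizon t: at a time s < t it is only known to be measurable for
    the coordinates up to t, so by itself it is not progressive. *)
Lemma progressively_measurable_factor B T alpha t :
  progressively_measurable T B alpha -> 0 <= t -> t <= T ->
  exists2 Phi : R * (R -> R) -> R,
    measurable_fun [set: R * g_sigma_algebraType (coord_gen t)] Phi &
    forall s w, 0 <= s <= t -> alpha s w = Phi (s, path_of B w).
Proof.
move=> pa t0 tT.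
have [|Phi mPhi PhiE] :=
  measurable_factor _ (@prod_natural_sigma B t) (pa t t0 tT).
  exact: measurableX.
exists Phi => // s w st.
by have -> := PhiE (s, w) => //; split => //=; rewrite in_itv.
Qed.

End path.

(** * Uniqueness of the law of Brownian motion on path space *)

Section law.
Context {R : realType}.

(** The properties that determine the law on path space; continuity of paths is left out, and the
    starting point enters through its Dirac law. *)
Record brownian_law {d} {Omega : measurableType d} (P : probability Omega R)
    (T : R) (B : R -> Omega -> R) : Prop := {
  law_measurable : forall t, 0 <= t -> t <= T -> measurable_fun [set: Omega] (B
    t) ;
  law_start : forall U, measurable U -> P (B 0 @^-1` U) = \d_(0 : R) U ;
  law_incr : forall s t, 0 <= s -> s < t -> t <= T ->
    forall (A : set Omega) (U : set R),
      <<s natural_gen B s >> A -> measurable U ->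
      P (A `&` increment B s t @^-1` U) =
        (P A * normal_prob 0 (Num.sqrt (t - s)) U)%E }.

Definition coords_gen (ts : set R) : set (set (R -> R)) :=
  \bigcup_(s in ts) preimage_set_system setT (fun x => x s) measurable.

Lemma coords_genS (S1 S2 : set R) : S1 `<=` S2 -> coords_gen S1 `<=` coords_gen
  S2.
Proof. by move=> S12 A [s /S12 S2s ?]; exists s. Qed.

Lemma sigma_coordsS (S1 S2 : set R) :
  S1 `<=` S2 -> <<s coords_gen S1 >> `<=` <<s coords_gen S2 >>.
Proof. by move=> ?; apply: sub_sigma_algebra2; exact: coords_genS. Qed.

Lemma path_of_measurable {d} {Omega : measurableType d} T (B : R -> Omega -> R) :
  (forall t, 0 <= t -> t <= T -> measurable_fun [set: Omega] (B t)) ->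
  @measurable_fun _ _ Omega (g_sigma_algebraType (coord_gen T)) setT (path_of B).
Proof.
move=> mB; apply: (@measurability _ _ _ (g_sigma_algebraType (coord_gen T)) _ _
  (coord_gen T)) => //.
move=> _ [_ [s /= sT [U mU <-]] <-].
move: sT; rewrite in_itv /= => /andP[s0 sT].
by rewrite !setTI -[X in measurable X]setTI; apply: (mB s).
Qed.

Context {d1 d2 : measure_display}.
Context {Omega1 : measurableType d1} {Omega2 : measurableType d2}.
Variables (P1 : probability Omega1 R) (P2 : probability Omega2 R) (T : R).
Variables (B1 : R -> Omega1 -> R) (B2 : R -> Omega2 -> R).
Hypotheses (L1 : brownian_law P1 T B1) (L2 : brownian_law P2 T B2).

Let XT := g_sigma_algebraType (coord_gen T).

Let mB1 : @measurable_fun _ _ Omega1 XT setT (path_of B1).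
Proof. apply: path_of_measurable; exact: law_measurable L1. Qed.
Let mB2 : @measurable_fun _ _ Omega2 XT setT (path_of B2).
Proof. apply: path_of_measurable; exact: law_measurable L2. Qed.

Let m1 : {measure set XT -> \bar R}.
Proof. by apply: (pushforward P1 (path_of B1 : Omega1 -> XT)). Defined.
Let m2 : {measure set XT -> \bar R}.
Proof. by apply: (pushforward P2 (path_of B2 : Omega2 -> XT)). Defined.

Let coords_le (s : R) (ts : set R) : ts `<=` `[0, s] ->
  <<s coords_gen ts >> `<=` <<s coord_gen s >>.
Proof. by move=> ?; apply: sigma_coordsS. Qed.

(** Induction along a decreasing list of times ending at 0. The family [G] of events combining the
    older times with the newest increment is stable under intersection, and on it both laws factor
    by independence of increments. *)
Let same_law_sorted (ts : seq R) (s : R) : path >%R s ts -> last s ts = 0 ->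
  s <= T -> forall A, <<s coords_gen [set` s :: ts] >> A -> m1 A = m2 A.
Proof.
elim: ts s => [|s' ts IH] s /=.
  move=> _ -> T0 A.
  have -> : [set` [:: 0]] = [set (0 : R)].
    by apply/seteqP; split => x /=; rewrite inE => /eqP.
  rewrite /coords_gen bigcup_set1 g_sigma_preimageE.
  move=> [U mU <-]; rewrite setTI /m1 /m2 /= /pushforward.
  have mU' : measurable U by move: mU;
    rewrite /measurable/= sigma_algebra_id//; exact: sigma_algebra_measurable.
  by rewrite (law_start L1 mU') (law_start L2 mU').
move=> /andP[ss' ps'] ls sT.
have s'T : s' <= T by rewrite (le_trans _ sT)// ltW.
have {}IH := IH s' ps' ls s'T.
have le0 (x : R) (l : seq R) (u : R) : path >%R x l -> last x l = 0 -> u \in x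
  :: l -> 0 <= u <= x.
  elim: l x u => [|y l IHl] x u /=.
    by move=> _ -> ; rewrite inE => /eqP ->; rewrite lexx.
  move=> /andP[xy pl] ll; rewrite inE => /orP[/eqP ->|ul].
    have /andP[y0 _] := IHl y y pl ll (mem_head _ _).
    by rewrite lexx andbT (le_trans y0)// ltW.
  have /andP[-> /le_trans] := IHl y u pl ll ul.
  by apply; rewrite ltW.
have ts0 : [set` s' :: ts] `<=` `[0, s'].
  by move=> u /= us; rewrite in_itv /=; exact: le0 us.
have s'0 : 0 <= s' by have /andP[] := le0 s' ts s' ps' ls (mem_head _ _).
pose D : XT -> R := fun x => x s - x s'.
pose G : set (set XT) := [set A `&` D @^-1` U |
  A in <<s coords_gen [set` s' :: ts] >> & U in (@measurable _ R)].
have mcoord u : 0 <= u <= T -> measurable_fun setT (fun x : XT => x u).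
  move=> u0T _ U mU; apply: sub_sigma_algebra; exists u;
    first by rewrite /= in_itv.
  by exists U.
have Gm : G `<=` measurable.
  move=> _ [A sA [U mU <-]]; apply: measurableI.
    move: sA; apply: sigma_coordsS => u /ts0 /=.
    by rewrite !in_itv /= => /andP[-> /le_trans]; apply.
  rewrite -[X in measurable X]setTI; apply: measurable_funB => //.
    by apply: mcoord; rewrite sT andbT (le_trans s'0)// ltW.
  by apply: mcoord; rewrite s'T andbT.
move=> A sA.
apply: (@g_sigma_algebra_measure_unique _ R XT G Gm (fun=> setT)) => //.
- move=> _; exists setT;
    first by exact: (@measurableT _ (g_sigma_algebraType (coords_gen [set` s'
      :: ts]))).
  by exists setT => //; rewrite setTI.
- by rewrite bigcup_const.
- move=> _ _ [A1 sA1 [U1 mU1 <-]] [A2 sA2 [U2 mU2 <-]].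
  exists (A1 `&` A2).
    exact: (@measurableI _ (g_sigma_algebraType (coords_gen [set` s' :: ts]))).
  exists (U1 `&` U2); first exact: measurableI.
  by rewrite preimage_setI setIACA.
- move=> _ [A1 sA1 [U1 mU1 <-]].
  have nat1 : <<s natural_gen B1 s' >> (path_of B1 @^-1` A1).
    rewrite natural_sigmaE; exists A1; last by rewrite setTI.
    exact: coords_le sA1.
  have nat2 : <<s natural_gen B2 s' >> (path_of B2 @^-1` A1).
    rewrite natural_sigmaE; exists A1; last by rewrite setTI.
    exact: coords_le sA1.
  have := law_incr L1 s'0 ss' sT nat1 mU1.
  have := law_incr L2 s'0 ss' sT nat2 mU1.
  have := IH _ sA1; rewrite /m1 /m2 /= /pushforward => E E2 E1.
  by rewrite !preimage_setI [LHS]E1 [RHS]E2 E.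
- by move=> _; rewrite /m1 /= /pushforward preimage_setT probability_setT ltry.
- move: A sA; apply: smallest_sub; first exact: smallest_sigma_algebra.
  pose YG := g_sigma_algebraType G.
  have mold u : u \in s' :: ts -> measurable_fun setT (fun x : YG => x u).
    move=> us _ U mU; apply: sub_sigma_algebra; rewrite setTI.
    exists ((fun x : XT => x u) @^-1` U).
      by apply: sub_sigma_algebra; exists u => //; exists U => //; rewrite setTI.
    by exists setT => //; rewrite preimage_setT setIT.
  move=> _ [u /= + [U mU <-]]; rewrite inE => /orP[/eqP ->|us]; last first.
    by exact: (mold u us measurableT U mU).
  (* The coordinate at s is the coordinate at s' plus the increment, and both are measurable for the
     sigma-algebra generated by [G]. *)
  suff mus : measurable_fun setT (fun x : YG =>
    x s) by exact: (mus measurableT U mU).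
  have -> : (fun x : YG => x s) = (fun x : YG => x s') \+ (fun x : YG =>
    x s - x s').
    by apply/funext => x /=; rewrite addrC subrK.
  apply: measurable_funD; first by apply: mold; rewrite mem_head.
  move=> _ V mV; apply: sub_sigma_algebra; rewrite setTI.
  exists setT; first by exact: (@measurableT _ (g_sigma_algebraType (coords_gen
    [set` s' :: ts]))).
  by exists V => //; rewrite setTI.
Qed.

(** Events depending on finitely many times form the family [K], which is stable under intersection
    (concatenate the lists) and generates; on it the laws agree by [same_law_sorted]. *)
Lemma brownian_same_law (A : set (R -> R)) : 0 <= T -> <<s coord_gen T >> A ->
  P1 (path_of B1 @^-1` A) = P2 (path_of B2 @^-1` A).
Proof.
move=> T0 sA.
have fin (l : seq R) : (forall u, u \in l -> 0 <= u <= T) -> forall C,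
    <<s coords_gen [set` l] >> C -> m1 C = m2 C.
  move=> l0T C sC.
  (* Adding the time 0, removing repetitions, sorting and reversing yields a strictly decreasing
     list; its last entry is its minimum, hence 0. *)
  have := sort_lt_sorted (undup (0 :: l)).
  rewrite undup_uniq -rev_sorted.
  set r := rev _; have rl u : (u \in r) = (u \in 0 :: l).
    by rewrite mem_rev mem_sort mem_undup.
  have [r0 rE] : 0 \in r /\ (forall u, u \in r -> 0 <= u <= T).
    split; first by rewrite rl mem_head.
    by move=> u; rewrite rl inE => /orP[/eqP ->|/l0T//]; rewrite lexx.
  have : <<s coords_gen [set` r] >> C.
    move: sC; apply: sigma_coordsS => u /= ul.
    by rewrite rl inE ul orbT.
  clearbody r; case: r r0 rE {rl} => // x r r0 rE sC' /= pr.
  have last_le (y : R) (q : seq R) (u : R) :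
      path >%R y q -> u \in y :: q -> last y q <= u.
    elim: q y u => [|z q IHq] y u /=; first by rewrite inE => _ /eqP ->.
    move=> /andP[zy pq]; rewrite inE => /orP[/eqP ->|]; last exact: IHq.
    by rewrite (le_trans (IHq z z pq (mem_head _ _)))// ltW.
  apply: (same_law_sorted pr _ _ sC').
    apply/eqP; rewrite eq_le (last_le _ _ _ pr r0)/=.
    by have /andP[] := rE _ (mem_last x r).
  by have /andP[] := rE _ (mem_head x r).
pose K := [set C : set (R -> R) | exists2 l : seq R,
  (forall u, u \in l -> 0 <= u <= T) & <<s coords_gen [set` l] >> C].
have coordsT (l : seq R) : (forall u, u \in l -> 0 <= u <= T) -> [set` l] `<=`
  `[0, T].
  by move=> lT u /= /lT; rewrite in_itv.
change (m1 A = m2 A).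
apply: (@g_sigma_algebra_measure_unique _ R XT K _ (fun=> setT)) => //.
- by move=> C [l /coordsT lT]; exact: sigma_coordsS.
- move=> _; exists [::] => //.
  exact: (@measurableT _ (g_sigma_algebraType (coords_gen [set` [::]]))).
- by rewrite bigcup_const.
- move=> C1 C2 [l1 l1T sC1] [l2 l2T sC2]; exists (l1 ++ l2).
    by move=> u; rewrite mem_cat => /orP[/l1T|/l2T].
  apply: (@measurableI _ (g_sigma_algebraType (coords_gen [set` l1 ++ l2]))).
    by move: sC1; apply: sigma_coordsS => u /= u1; rewrite mem_cat u1.
  by move: sC2; apply: sigma_coordsS => u /= u1; rewrite mem_cat u1 orbT.
- by move=> C [l lT sC]; exact: fin lT _ sC.
- by move=> _; rewrite /m1 /= /pushforward preimage_setT probability_setT ltry.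
- move: sA; apply: sub_sigma_algebra2 => C [u /= uT ?]; exists [:: u].
    by move=> v; rewrite inE => /eqP ->; move: uT; rewrite in_itv.
  by apply: sub_sigma_algebra; exists u => //=; rewrite mem_head.
Qed.
End law.

(** * Brownian scaling and homogeneity of the norms *)

Section scaling.
Context {R : realType}.

Lemma normal_prob_scale (a sigma : R) (U : set R) : 0 < a -> 0 < sigma ->
  measurable U ->
  normal_prob 0 (a * sigma) ((fun x => a^-1 * x) @^-1` U) = normal_prob 0 sigma U.
Proof.
move=> a0 s0 mU; rewrite /normal_prob.
have ai0 : 0 < a^-1 by rewrite invr_gt0.
have mpdf s : measurable_fun setT (fun x : R => (normal_pdf 0 s x)%:E).
  by apply/measurable_EFinP; exact: measurable_normal_pdf.
rewrite [RHS](ge0_integral_affine 0 ai0 mU); last 2 first.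
- by apply: measurable_funTS; exact: mpdf.
- by move=> x _; rewrite lee_fin normal_pdf_ge0.
have -> : (fun y : R => a^-1 * y + 0) @^-1` U = (fun x => a^-1 * x) @^-1` U.
  by apply/seteqP; split => y /=; rewrite addr0.
rewrite -ge0_integralZl_EFin ?ltW//.
- apply: eq_integral => x _; rewrite addr0 -EFinM; congr (_%:E).
  rewrite !normal_pdfE ?gt_eqF ?mulr_gt0// /normal_peak /normal_fun !subr0.
  rewrite mulrA; congr (_ * expR _).
    rewrite exprMn -mulrA -mulrnAr sqrtrM ?sqr_ge0// invfM sqrtr_sqr gtr0_norm//.
  rewrite exprMn -mulrnAr invfM exprMn exprVn !mulNr; congr (- _).
  by rewrite mulrCA mulrA.
- rewrite -[X in measurable X]setTI;
    apply: (measurable_funM (f := cst a^-1)) => //.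
- by move=> x _; rewrite lee_fin normal_pdf_ge0.
- apply: measurable_funTS; apply: (measurableT_comp (mpdf sigma)).
  by apply: measurable_funD => //; exact: measurable_funM.
Qed.

Context {d} {Omega : measurableType d}.

Lemma ae_cst_law (P : probability Omega R) (X : Omega -> R) (a : R) (U : set R) :
  measurable_fun setT X -> (\forall w \ae P, X w = a) -> measurable U ->
  P (X @^-1` U) = \d_a U.
Proof.
move=> mX Xa mU; have mXU : measurable (X @^-1` U).
  by rewrite -[X in measurable X]setTI; exact: mX.
have [aU|aU] := pselect (U a).
  rewrite diracE mem_set//=; apply/eqP; rewrite -(setCK (X @^-1` U)).
  rewrite probability_setC; last exact: measurableC.
  rewrite (@measure_negligible _ _ _ P (~` (X @^-1` U))) ?sube0//.
    exact: measurableC.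
  by apply: negligibleS Xa => w /= XU /= Xw; apply: XU; rewrite Xw.
rewrite diracE memNset//=; apply: measure_negligible => //.
by apply: negligibleS Xa => w /= XU /= Xw; apply: aU; rewrite -Xw.
Qed.

Definition rescale (a : R) (B : R -> Omega -> R) : R -> Omega -> R :=
  fun t w => a^-1 * B (a ^+ 2 * t) w.

Lemma natural_rescale a (B : R -> Omega -> R) s : 0 < a ->
  <<s natural_gen (rescale a B) s >> `<=` <<s natural_gen B (a ^+ 2 * s) >>.
Proof.
move=> a0; apply: smallest_sub; first exact: smallest_sigma_algebra.
move=> _ [u /= us [U mU <-]]; apply: sub_sigma_algebra.
exists (a ^+ 2 * u).
  by move: us; rewrite /= !in_itv /= => /andP[u0 us];
    rewrite mulr_ge0 ?sqr_ge0//= ler_pM2l// exprn_gt0.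
exists ((fun x => a^-1 * x) @^-1` U) => //.
by rewrite -[X in measurable X]setTI; apply: (measurable_funM (f := cst a^-1)).
Qed.

(** An increment of B over [a^2 s, a^2 t] has standard deviation a sqrt(t - s), which the factor 1/a
    normalizes; independence is inherited because the rescaled filtration at s lies in that of B at
    a^2 s. *)
Lemma brownian_law_rescale (P : probability Omega R) a T B : 0 < a -> 0 <= T ->
  brownian_motion P (a ^+ 2 * T) B -> brownian_law P T (rescale a B).
Proof.
move=> a0 T0 [mB B0 _ Bindep Bnorm].
have a20 : 0 < a ^+ 2 by rewrite exprn_gt0.
have mmul (U : set R) : measurable U -> measurable ((fun x => a^-1 * x) @^-1` U).
  by move=> mU; rewrite -[X in measurable X]setTI;
    apply: (measurable_funM (f := cst a^-1)).
have mrB t : 0 <= t -> t <= T -> measurable_fun [set: Omega] (rescale a B t).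
  move=> t0 tT; apply: measurable_funM => //; apply: mB.
    by rewrite mulr_ge0// ltW.
  by rewrite ler_pM2l.
split => //.
- move=> U mU; apply: ae_cst_law => //; first exact: mrB.
  by apply: filterS B0 => w; rewrite /rescale mulr0 => ->; rewrite mulr0.
- move=> s t s0 st tT C U sC mU.
  have -> : increment (rescale a B) s t @^-1` U =
      increment B (a ^+ 2 * s) (a ^+ 2 * t) @^-1` ((fun x => a^-1 * x) @^-1` U).
    by apply/seteqP; split => w /=; rewrite /increment /rescale mulrBr.
  have s0' : 0 <= a ^+ 2 * s by rewrite mulr_ge0// ltW.
  have st' : a ^+ 2 * s < a ^+ 2 * t by rewrite ltr_pM2l.
  have tT' : a ^+ 2 * t <= a ^+ 2 * T by rewrite ler_pM2l.
  rewrite (Bindep _ _ s0' (ltW st') tT') //; last 2 first.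
  + exact: natural_rescale sC.
  + exact: mmul.
  rewrite (Bnorm _ _ s0' st' tT'); last exact: mmul.
  rewrite -mulrBr sqrtrM ?sqr_ge0// sqrtr_sqr gtr0_norm// normal_prob_scale//.
  by rewrite sqrtr_gt0 subr_gt0.
Qed.

Lemma rescale1 (B : R -> Omega -> R) : rescale 1 B = B.
Proof.
by apply/funext => t; apply/funext => w;
  rewrite /rescale invr1 mul1r expr1n mul1r.
Qed.

Lemma brownian_motion_law (P : probability Omega R) T B : 0 <= T ->
  brownian_motion P T B -> brownian_law P T B.
Proof.
move=> T0 HB; rewrite -(rescale1 B); apply: brownian_law_rescale => //.
by rewrite expr1n mul1r.
Qed.

Lemma Lnorm2Z (P : probability Omega R) (r : R) (f : Omega -> R) : 0 <= r ->
  measurable_fun setT f ->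
  ('N[P]_2%:E [EFin \o (fun w => r * f w)%R] = r%:E * 'N[P]_2%:E [EFin \o f])%E.
Proof.
move=> r0 mf; rewrite unlock /Lnorm /=.
have -> : (\int[P]_x (`|(r * f x)%:E| `^ 2) = (r ^+ 2)%:E * \int[P]_x (`|(f
  x)%:E| `^ 2))%E.
  rewrite -ge0_integralZl_EFin ?sqr_ge0//.
  - apply: eq_integral => x _; rewrite EFinM abseM poweRM ?abse_ge0//.
    by rewrite abse_EFin ger0_norm// poweR_EFin powR_mulrn.
  - by move=> x _; exact: poweR_ge0.
  - under eq_fun do rewrite abse_EFin poweR_EFin.
    apply/measurable_EFinP; apply: (measurableT_comp (measurable_powR 2)).
    exact: measurableT_comp.
rewrite poweRM ?lee_fin ?sqr_ge0//; last by apply: integral_ge0 => x _;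
  exact: poweR_ge0.
by rewrite poweR_EFin -powR_mulrn// -powRrM mulfV// powRr1.
Qed.

Lemma LnormyZ (P : probability Omega R) (r : R) (f : Omega -> R) : 0 <= r ->
  ('N[P]_+oo [EFin \o (fun w => r * f w)%R] = r%:E * 'N[P]_+oo [EFin \o f])%E.
Proof.
move=> r0; rewrite unlock /Lnorm /= probability_setT lte01 -ess_supZl//;
  last by rewrite /= (@probability_setT _ _ _ P) lte01.
by congr ess_sup; apply/funext => w /=; rewrite normrM ger0_norm// EFinM.
Qed.

Lemma Lnorm2_le (P : probability Omega R) (c : R) (f : Omega -> R) : 0 <= c ->
  ('N[P]_2%:E [EFin \o f] <= c%:E <-> \int[P]_w ((f w) ^+ 2)%:E <= (c ^+ 2)%:E)%E.
Proof.
move=> c0.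
have -> : (\int[P]_w ((f w) ^+ 2)%:E = 'N[P]_2%:E [EFin \o f] `^ 2)%E.
  rewrite poweR_Lnorm//; apply: eq_integral => w _ /=.
  by rewrite powR_mulrn// real_normK// num_real.
have N0 := Lnorm_ge0 P 2%:E (EFin \o f).
have -> : ((c ^+ 2)%:E = c%:E `^ 2)%E by rewrite poweR_EFin powR_mulrn.
split=> [Nc|]; first by apply: gt0_ler_poweR => //;
  rewrite in_itv /= ?N0 ?leey ?lee_fin ?c0.
move: N0; case: ('N[P]_2%:E[_])%E => [x| |] //; last by rewrite poweRyr.
by rewrite !lee_fin => x0; rewrite !powR_mulrn// ler_pXn2r.
Qed.
End scaling.

(** * Countable gluing of functionals and measurability of time integrals *)

Section glue.
Context {R : realType} {X : Type}.
Variables (D : nat -> set R) (F : nat -> R -> X -> R).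

(** A definition by countably many cases: [cid] picks an index, which is unique when the pieces are
    disjoint. *)
Definition glue (s : R) (x : X) : R :=
  if pselect (exists n, D n s) is left e then F (projT1 (cid e)) s x else 0.

Lemma glueE n s x : trivIset setT D -> D n s -> glue s x = F n s x.
Proof.
move=> tD Dns; rewrite /glue; case: pselect => [e|]; last by case; exists n.
case: (cid e) => m /= Dms; congr (F _ s x).
by apply: tD => //; exists s.
Qed.

Lemma glue0 s x : ~ (\bigcup_n D n) s -> glue s x = 0.
Proof.
move=> Ds; rewrite /glue; case: pselect => // -[n Dns].
by exfalso; apply: Ds; exists n.
Qed.

End glue.

Section glue_measurable.
Context {R : realType} {d} {X : measurableType d}.

Lemma measurable_glue (D : nat -> set R) (F : nat -> R -> X -> R) (C : set R) :
  measurable C -> (forall n, measurable (D n)) -> trivIset setT D ->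
  (forall n, measurable_fun ((C `&` D n) `*` setT) (fun z : R * X =>
    F n z.1 z.2)) ->
  measurable_fun (C `*` setT) (fun z : R * X => glue D F z.1 z.2).
Proof.
move=> mC mD tD mF.
(* Index 0 holds the complement of all pieces, where [glue] vanishes; the piece [D m] moves to
   [m.+1]. *)
pose D' n := if n is m.+1 then D m else ~` \bigcup_n D n.
have mD' n : measurable (D' n).
  by case: n => [|n]; [apply: measurableC; exact: bigcupT_measurable|exact: mD].
have CE : C `*` setT = \bigcup_n ((C `&` D' n) `*` [set: X]).
  apply/seteqP; split => [[s x] [/= Cs _]|[s x] [n _ [[]]]] //.
  have [[n _ Dns]|nD] := pselect ((\bigcup_n D n) s); first by exists n.+1.
  by exists 0%N.
rewrite CE; apply/measurable_fun_bigcup.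
  by move=> n; apply: measurableX => //; exact: measurableI.
case=> [|n].
  apply: (@eq_measurable_fun _ _ _ _ _ (cst (0 : R))) =>
    // -[s x] /set_mem[[_ /= nD] _].
  by rewrite glue0.
apply: eq_measurable_fun (mF n) => -[s x] /set_mem[[_ /= Dns] _] /=.
by rewrite (glueE F x tD Dns).
Qed.

(** The integral is the difference of those of the positive and negative parts, each measurable in x
    by Tonelli; no integrability enters. *)
Lemma measurable_param_integral (D : set R) (f : R * X -> R) :
  measurable D -> measurable_fun (D `*` setT) f ->
  measurable_fun [set: X]
    (fun x => \int[lebesgue_measure]_(s in D) (f (s, x))%:E)%E.
Proof.
move=> mD mf.
have mDT : measurable (D `*` [set: X]) by exact: measurableX.
pose g : R * X -> \bar R := (EFin \o f) \_ (D `*` setT).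
have mg : measurable_fun setT g.
  have /(measurable_restrictT _ mDT) : measurable_fun (D `*` [set: X]) (EFin \o
    f) by exact/measurable_EFinP.
  by [].
have gE x : (fun s => (f (s, x))%:E) \_ D = (fun s => g (s, x)).
  apply/funext => s; rewrite /g /patch; case: ifPn => [/set_mem Ds|nDs].
    by rewrite mem_set.
  by rewrite memNset// => -[/= /mem_set]; rewrite (negbTE nDs).
under eq_fun do rewrite integral_mkcond gE integralE.
apply: emeasurable_funB.
- have := @measurable_fun_fubini_tonelli_G _ _ _ _ R lebesgue_measure _
    (measurable_funepos mg) (fun=> funepos_ge0 _ _).
  rewrite /fubini_G; congr (measurable_fun _ _).
  by apply/funext => x; apply: eq_integral => s _; rewrite !funeposE.
- have := @measurable_fun_fubini_tonelli_G _ _ _ _ R lebesgue_measure _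
    (measurable_funeneg mg) (fun=> funeneg_ge0 _ _).
  rewrite /fubini_G; congr (measurable_fun _ _).
  by apply/funext => x; apply: eq_integral => s _; rewrite !funenegE.
Qed.

End glue_measurable.

(** * Norms of path functionals depend only on the law *)

Section law_norm.
Context {R : realType} {d1 d2 : measure_display}.
Context {Omega1 : measurableType d1} {Omega2 : measurableType d2}.
Variables (P1 : probability Omega1 R) (P2 : probability Omega2 R) (T : R).
Variables (B1 : R -> Omega1 -> R) (B2 : R -> Omega2 -> R).
Hypotheses (T0 : 0 <= T) (L1 : brownian_law P1 T B1) (L2 : brownian_law P2 T B2).

Let XT := g_sigma_algebraType (coord_gen T).
Let mB1 : @measurable_fun _ _ Omega1 XT setT (path_of B1).
Proof. apply: path_of_measurable; exact: law_measurable L1. Qed.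
Let mB2 : @measurable_fun _ _ Omega2 XT setT (path_of B2).
Proof. apply: path_of_measurable; exact: law_measurable L2. Qed.

Lemma same_law_Lnorm2 (h : XT -> R) : measurable_fun setT h ->
  ('N[P1]_2%:E [EFin \o (h \o path_of B1)] = 'N[P2]_2%:E [EFin \o (h \o path_of
    B2)])%E.
Proof.
move=> mh; rewrite unlock /Lnorm /=; congr (_ `^ _)%E.
pose g (x : XT) := ((`|(h x)%:E| `^ 2)%E).
have mg : measurable_fun setT g.
  have -> : g = EFin \o (fun x => `|h x| `^ 2).
    by apply/funext => x; rewrite /g abse_EFin poweR_EFin.
  apply/measurable_EFinP; apply: (measurableT_comp (measurable_powR 2)).
  exact: measurableT_comp.
have := @ge0_integral_pushforward _ _ _ _ R _ mB1 P1 setT g measurableT mg (fun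
  x _ => poweR_ge0 _ _).
have := @ge0_integral_pushforward _ _ _ _ R _ mB2 P2 setT g measurableT mg (fun
  x _ => poweR_ge0 _ _).
rewrite !preimage_setT => <- <-.
apply: eq_measure_integral => A mA _.
exact: (brownian_same_law L1 L2 T0).
Qed.

Lemma same_law_Lnormy (h : XT -> R) : measurable_fun setT h ->
  ('N[P1]_+oo [EFin \o (h \o path_of B1)] = 'N[P2]_+oo [EFin \o (h \o path_of
    B2)])%E.
Proof.
move=> mh; rewrite unlock /Lnorm /= !probability_setT lte01.
have mah : measurable_fun setT (fun x : XT => `|(h x)%:E|)%E.
  by apply: measurableT_comp => //; exact/measurable_EFinP.
rewrite !ess_supEmu0; last 2 first.
- exact: (measurableT_comp mah mB2).
- exact: (measurableT_comp mah mB1).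
congr ereal_inf; apply/seteqP.
(* The essential supremum is the infimum of the levels y whose strict upper level set is null, so
   equal probabilities of these sets suffice. *)
have E y : P1 ((abse \o (EFin \o (h \o path_of B1))) @^-1` `]y, +oo[) =
   P2 ((abse \o (EFin \o (h \o path_of B2))) @^-1` `]y, +oo[).
  have := brownian_same_law L1 L2 T0 (A := (fun x : XT =>
    `|(h x)%:E|)%E @^-1` `]y, +oo[).
  apply; rewrite -[X in <<s _ >> X]setTI.
  apply: mah => //; exact: emeasurable_itv.
by split => y /=; rewrite E.
Qed.

End law_norm.

(** For c = sqrt(2/pi) this is the class [admissible]. *)
Definition bounded_controls {R : realType} {d} {Omega : measurableType d}
    (P : probability Omega R) (T : R) (B : R -> Omega -> R) (c : R) :
    set (R -> Omega -> R) :=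
  [set alpha | progressively_measurable T B alpha /\
    forall t, 0 <= t -> t <= T -> ('N[P]_2%:E [EFin \o alpha t] <= c%:E)%E].

(** * Transport of a control to another Brownian motion by a vanishing delay *)

Section transfer.
Context {R : realType} {d1 d2 : measure_display}.
Context {Omega1 : measurableType d1} {Omega2 : measurableType d2}.

Lemma measurable_path_rescale (a q t : R) (B : R -> Omega2 -> R) :
  0 < a -> a ^+ 2 * q <= t ->
  @measurable_fun _ _ (g_sigma_algebraType (natural_gen B t))
    (g_sigma_algebraType (coord_gen q)) setT (path_of (rescale a B)).
Proof.
move=> a0 aqt.
apply: (@measurability _ _ _ (g_sigma_algebraType (coord_gen q)) _ _ (coord_gen
  q)) => //.
move=> _ [_ [u /= uq [U mU <-]] <-]; rewrite !setTI.
move: uq; rewrite in_itv /= => /andP[u0 uq].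
apply: sub_sigma_algebra; exists (a ^+ 2 * u).
  rewrite /= in_itv /= mulr_ge0 ?sqr_ge0//= (le_trans _ aqt)//.
  by rewrite ler_pM2l// exprn_gt0.
exists ((fun x => a^-1 * x) @^-1` U); last by rewrite setTI.
by rewrite -[X in measurable X]setTI; apply: (measurable_funM (f := cst a^-1)).
Qed.

Lemma measurable_coord_gen_le (q t : R) (d3 : measure_display) (Y :
  measurableType d3)
    (f : (R -> R) -> Y) : q <= t ->
  @measurable_fun _ _ (g_sigma_algebraType (coord_gen q)) Y setT f ->
  @measurable_fun _ _ (g_sigma_algebraType (coord_gen t)) Y setT f.
Proof.
move=> qt mf _ U mU; have := mf measurableT U mU.
apply: sub_sigma_algebra2 => A [s /= sq HA]; exists s => //=.
by move: sq; rewrite !in_itv /= => /andP[-> /le_trans]; apply.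
Qed.

Variables (P1 : probability Omega1 R) (P2 : probability Omega2 R).
Variables (B1 : R -> Omega1 -> R) (B2 : R -> Omega2 -> R).
Variables (T a k c : R).
Hypotheses (T0 : 0 < T) (a0 : 0 < a) (k0 : 0 < k) (k1 : k < 1) (c0 : 0 <= c).
Hypothesis HB1 : brownian_motion P1 T B1.
Hypothesis HB2 : brownian_motion P2 (a ^+ 2 * T) B2.
Variable alpha : R -> Omega1 -> R.
Hypothesis Halpha : bounded_controls P1 T B1 c alpha.

(* theta lags behind the rescaled clock: theta s < s / a ^ 2 for s < T2, with
   equality at s = T2. The new control at time s reads alpha at time theta s
   through a functional of the path up to a rational q_ n in [theta s, s / a ^ 2];
   E n is the set of the times s for which q_ n can be used. *)
Let XT := g_sigma_algebraType (coord_gen T).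
Let T2 := a ^+ 2 * T.
Let K := (a ^+ 2 * k)^-1.
Let theta s := K * s + (T - T / k).
Let q_ n : R := ratr (odflt 0 (unpickle n) : rat).
Let E n := `[(1 - k) * T2, T2[ `&` `[a ^+ 2 * q_ n, (q_ n - (T - T / k)) / K].
Let D := seqDU E.

Let K0 : 0 < K. Proof. by rewrite invr_gt0 mulr_gt0// exprn_gt0. Qed.
Let a20 : 0 < a ^+ 2. Proof. by rewrite exprn_gt0. Qed.
Let T20 : 0 < T2. Proof. by rewrite mulr_gt0. Qed.

Let mE n : measurable (E n). Proof. exact: measurableI. Qed.
Let mD n : measurable (D n). Proof. exact: seqDU_measurable. Qed.
Let tD : trivIset setT D. Proof. exact: trivIset_seqDU. Qed.

(** Together with [theta_ub], this displays [theta] as the affine bijection from [(1 - k) T2, T2]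
    onto [0, T]. *)
Let theta_lb s : theta s = K * (s - (1 - k) * T2).
Proof. by rewrite /theta /K /T2; field; rewrite !gt_eqF. Qed.

Let theta_ub s : T - theta s = K * (T2 - s).
Proof. by rewrite /theta /K /T2; field; rewrite !gt_eqF. Qed.

Let theta_ge0 s : (1 - k) * T2 <= s -> 0 <= theta s.
Proof.
by move=> ks; rewrite theta_lb mulr_ge0 ?subr_ge0// ltW.
Qed.

Let E_theta n s : E n s -> [/\ (1 - k) * T2 <= s, s < T2, theta s <= q_ n & a
  ^+ 2 * q_ n <= s].
Proof.
move=> [h1 h2]; move: h1 h2; rewrite /= !in_itv /= => /andP[-> ->] /andP[-> h];
  split => //.
by rewrite -lerBrDr mulrC -ler_pdivlMr.
Qed.

Let q_T n s : E n s -> 0 <= q_ n <= T.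
Proof.
move=> /E_theta[ks sT2 tq qs]; rewrite (le_trans (theta_ge0 ks) tq)/=.
by rewrite -(ler_pM2l a20) (le_trans qs)// ltW.
Qed.

Let bigcupD : \bigcup_n D n = `[(1 - k) * T2, T2[%classic.
Proof.
rewrite -seqDU_bigcup_eq; apply/seteqP; split => [s [n _ []]//|s /[dup] Is].
rewrite /= in_itv /= => /andP[ks sT2].
(* The lag equals (T2 - s)(1 - k)K, positive before T2, so a rational fits between the two clocks;
   its code is the index of the piece. *)
have tlt : theta s < s / a ^+ 2.
  rewrite -subr_gt0.
  have -> : s / a ^+ 2 - theta s = (T2 - s) * (1 - k) * K.
    by rewrite /theta /K /T2; field; rewrite !gt_eqF.
  by rewrite !mulr_gt0// subr_gt0.
have [q] := rat_in_itvoo tlt; rewrite in_itv /= => /andP[tq qs].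
exists (pickle q) => //; split => //=; rewrite /q_ pickleK /= in_itv /=.
apply/andP; split; first by rewrite mulrC -ler_pdivlMr// ltW.
by rewrite ler_pdivlMr// mulrC lerBrDr ltW.
Qed.

(** Rationals outside [0, T] receive a dummy functional, so that [Phi] can be chosen as a total
    sequence. *)
Let ex_Phi n : exists Phi : R * (R -> R) -> R, 0 <= q_ n <= T ->
  measurable_fun [set: R * g_sigma_algebraType (coord_gen (q_ n))] Phi /\
  forall s w, 0 <= s <= q_ n -> alpha s w = Phi (s, path_of B1 w).
Proof.
have [/andP[q0 qT]|nq] := boolP (0 <= q_ n <= T); last by exists (fun=> 0).
have [Phi mPhi PhiE] := progressively_measurable_factor Halpha.1 q0 qT.
by exists Phi.
Qed.

Let Phi n := projT1 (cid (ex_Phi n)).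

Let mPhi n : 0 <= q_ n <= T ->
  measurable_fun [set: R * g_sigma_algebraType (coord_gen (q_ n))] (Phi n).
Proof. by move=> qT; have [] := projT2 (cid (ex_Phi n)) qT. Qed.

Let PhiE n s w : 0 <= q_ n <= T -> 0 <= s <= q_ n ->
  alpha s w = Phi n (s, path_of B1 w).
Proof. by move=> qT; have [_] := projT2 (cid (ex_Phi n)) qT; apply. Qed.

Let Psi : R -> (R -> R) -> R := glue D (fun n s x => Phi n (theta s, x)).

Let D_E n s : D n s -> E n s. Proof. by case. Qed.

Let mtheta : measurable_fun setT theta.
Proof. by apply: measurable_funD => //; exact: measurable_funM. Qed.

(** On the piece [E n] only the path up to [q_ n] is read, so f has to be measurable only for the
    horizons of the pieces meeting C. For C = [0, t] this yields progressive measurability, since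
    [a ^+ 2 * q_ n <= s <= t]. *)
Let measurable_Psi_comp {d} {X : measurableType d} (f : X -> R -> R) (C : set R) :
  measurable C ->
  (forall n s, C s -> E n s ->
    @measurable_fun _ _ X (g_sigma_algebraType (coord_gen (q_ n))) setT f) ->
  measurable_fun (C `*` [set: X]) (fun z => Psi z.1 (f z.2)).
Proof.
move=> mC mf.
have := @measurable_glue R _ X D (fun n s x => Phi n (theta s, f x)) C mC mD tD.
apply=> n.
have [[s [Cs Dns]]|nCD] := pselect (exists s, (C `&` D n) s); last first.
  rewrite (_ : _ `*` _ = set0); first exact: measurable_fun_set0.
  by apply/seteqP; split => // -[s x] [CDs _]; apply: nCD; exists s.
have mfn := mf n s Cs (D_E Dns).
apply: measurable_funTS.
apply: (measurableT_comp (mPhi (q_T (D_E Dns)))).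
apply: measurable_fun_pair; first exact: measurableT_comp.
exact: (measurableT_comp mfn).
Qed.

(** K is the slope of [theta] and compensates the change of time; a undoes the scaling of space. As
    a K = 1 / (a k), the bound c becomes c / (a k). *)
Let beta s w := (a * K) * Psi s (path_of (rescale a B2) w).

Let L1 : brownian_law P1 T B1.
Proof.
by apply: brownian_motion_law => //; exact: ltW.
Qed.

Let L2 : brownian_law P2 T (rescale a B2).
Proof. by apply: brownian_law_rescale => //; exact: ltW. Qed.

Let beta_pm : progressively_measurable T2 B2 beta.
Proof.
move=> t t0 tT2.
apply: (measurable_funM (f := cst (a * K))) => //.
apply: (@measurable_Psi_comp _ (g_sigma_algebraType (natural_gen B2 t))
  (path_of (rescale a B2)) `[0, t]).
  by [].
move=> n s; rewrite /= in_itv /= => /andP[s0 st] /E_theta[_ _ _ qs].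
by apply: measurable_path_rescale => //; exact: le_trans st.
Qed.
Let beta_law n s : D n s ->
  measurable_fun [set: XT] (fun x : XT => a * K * Phi n (theta s, x)).
Proof.
move=> /D_E Ens; apply: (measurable_funM (f := cst (a * K))) => //.
have /andP[q0 qT] := q_T Ens.
apply: (measurable_coord_gen_le qT).
apply: (measurableT_comp (mPhi (q_T Ens))).
exact: measurable_fun_pair.
Qed.

Let aK0 : 0 <= a * K. Proof. by rewrite mulr_ge0 ?ltW. Qed.

Let malpha s : 0 <= s -> s <= T -> measurable_fun setT (alpha s).
Proof.
move=> s0 sT; have [F mF FE] := progressively_measurable_factor Halpha.1 s0 sT.
have -> : alpha s = (fun x => F (s, x)) \o path_of B1.
  by apply/funext => w; rewrite (FE s w)//= s0 lexx.
apply: (@measurableT_comp _ _ _ _ (g_sigma_algebraType (coord_gen s))).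
  by apply: (measurableT_comp mF); exact: measurable_fun_pair.
apply: path_of_measurable => t t0 ts.
by apply: (law_measurable L1) => //; exact: le_trans sT.
Qed.

Let beta_norm s : 0 <= s -> s <= T2 ->
  ('N[P2]_2%:E [EFin \o beta s] <= (c / (a * k))%:E)%E.
Proof.
move=> s0 sT2.
have -> : c / (a * k) = (a * K) * c.
  by rewrite /K; field; rewrite !gt_eqF.
(* Before (1 - k) T2, and at T2 itself, the new control is 0; elsewhere its norm is a K times that
   of [alpha] at [theta s], by equality of laws. *)
have [[n _ Dns]|nD] := pselect ((\bigcup_n D n) s); last first.
  have -> : EFin \o beta s = cst 0%E.
    by apply/funext => w; rewrite /= /beta /Psi glue0// mulr0.
  have aKc : (0 <= (a * K * c)%:E)%E by rewrite lee_fin mulr_ge0.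
  by rewrite Lnorm0.
have -> : EFin \o beta s = EFin \o ((fun x =>
  a * K * Phi n (theta s, x)) \o path_of (rescale a B2)).
  by apply/funext => w; rewrite /= /beta /Psi (glueE _ _ tD Dns).
rewrite -(same_law_Lnorm2 (ltW T0) L1 L2 (beta_law Dns)).
have [ks _ tq _] := E_theta (D_E Dns).
have /andP[q0 qT] := q_T (D_E Dns).
have t0 := theta_ge0 ks.
have tT : theta s <= T by exact: le_trans qT.
have -> : EFin \o ((fun x => a * K * Phi n (theta s, x)) \o path_of B1) =
    EFin \o (fun w => a * K * alpha (theta s) w).
  apply/funext => w /=; rewrite (PhiE w (q_T (D_E Dns)))//.
  by rewrite t0 tq.
rewrite Lnorm2Z//; last exact: malpha.
rewrite [in leRHS](EFinM (a * K)); apply: lee_wpmul2l; first by rewrite lee_fin.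
exact: Halpha.2.
Qed.

(** One functional for both problems: along the rescaled [B2] it is the terminal value of [beta],
    along [B1] it is a times that of [alpha]. Equality of laws then compares the norms. *)
Let Y (x : R -> R) : R :=
  (\int[lebesgue_measure]_(s in `[0, T2]) (a * K * Psi s x)) + a * x T.

Let mY : measurable_fun [set: XT] Y.
Proof.
apply: measurable_funD.
  apply: measurableT_comp => //.
  apply: (@measurable_param_integral R _ XT `[0, T2] (fun z =>
    a * K * Psi z.1 z.2)) => //.
  apply: (measurable_funM (f := cst (a * K))) => //.
  apply: (@measurable_Psi_comp _ XT idfun `[0, T2]) => // n s _ Ens.
  have /andP[q0 qT] := q_T Ens.
  move=> _ U mU; move: (mU); rewrite setTI;
    apply: sub_sigma_algebra2 => V [s0 /= s0q HV]; exists s0 => //=.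
  by move: s0q; rewrite !in_itv /= => /andP[-> s0q]; rewrite (le_trans s0q).
apply: measurable_funM => //.
move=> _ U mU; apply: sub_sigma_algebra; exists T; last by exists U.
by rewrite /= in_itv /= lexx ltW.
Qed.

Let Y2 w : Y (path_of (rescale a B2) w) = terminal_value T2 B2 beta w.
Proof.
rewrite /Y /terminal_value /beta; congr (_ + _).
by rewrite /path_of /rescale mulrA mulfV ?gt_eqF// mul1r.
Qed.

Let alpha_path_measurable w : measurable_fun `[0, T] (fun s => alpha s w).
Proof.
have [F mF FE] := progressively_measurable_factor Halpha.1 (ltW T0) (lexx T).
apply: (@eq_measurable_fun _ _ _ _ _ (fun s => F (s, path_of B1 w))).
  by move=> s; rewrite inE /= in_itv /= => sT; rewrite -(FE s w).
apply: measurable_funTS; apply: (measurableT_comp mF).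
exact: measurable_fun_pair.
Qed.

Let Y1 w : Y (path_of B1 w) = a * terminal_value T B1 alpha w.
Proof.
rewrite /Y /terminal_value mulrDr; congr (_ + _).
rewrite /Rintegral.
have -> : (\int[lebesgue_measure]_(s in `[0%R, T2]) (a * K * Psi s (path_of B1
  w))%:E =
   a%:E * \int[lebesgue_measure]_(s in `[0%R, T]) (alpha s w)%:E)%E.
  (* The endpoint T is removed because the pieces [D n] cover only times before T2, where the lag is
     positive. *)
  rewrite -[in RHS]integral_itv_bndo_bndc; last first.
    by apply/measurable_EFinP;
      apply: measurable_funS (alpha_path_measurable w) => // s /=;
        rewrite !in_itv /= => /andP[-> /ltW].
  have m1 : measurable_fun `[0, T[ (fun s => (alpha s w)%:E).
    by apply/measurable_EFinP;
      apply: measurable_funS (alpha_path_measurable w) => // s /=;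
        rewrite !in_itv /= => /andP[-> /ltW].
  rewrite (integral_affine (T - T / k) K0 _ m1)//.
  have -> : (fun y => K * y + (T - T / k)) @^-1` `[0, T[ = `[(1 - k) * T2,
    T2[%classic.
    have tE y : (0 <= theta y < T) = ((1 - k) * T2 <= y < T2).
      by rewrite -(subr_gt0 (theta y)) theta_ub theta_lb pmulr_rge0//
        pmulr_rgt0// subr_ge0 subr_gt0.
    by apply/seteqP; split => y /=; rewrite !in_itv /= -?/(theta y) tE.
  rewrite muleA -EFinM -integral_pZl ?mulr_gt0//; last first.
    apply: (@measurable_comp _ _ _ _ _ _ `[0, T[ (fun s =>
      (alpha s w)%:E) _ theta) => //.
    + move=> _ [y /= + <-]; rewrite !in_itv /= => /andP[ky yT].
      by rewrite theta_ge0//= -subr_gt0 theta_ub mulr_gt0// subr_gt0.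
    + exact: measurable_funTS.
  rewrite [LHS]integral_mkcond [RHS]integral_mkcond; apply: eq_integral => s _.
  rewrite /patch; have [[n _ Dns]|nD] := pselect ((\bigcup_n D n) s).
    have [ks sT2 tq _] := E_theta (D_E Dns).
    have sI : `[(1 - k) * T2, T2[%classic s by rewrite /= in_itv /= ks.
    have s0T : `[0, T2]%classic s.
      by rewrite /= in_itv /= (ltW sT2) andbT (le_trans _ ks)// mulr_ge0
        ?subr_ge0 ?ltW.
    rewrite (mem_set sI) (mem_set s0T).
    rewrite /Psi (glueE _ _ tD Dns) -EFinM -/(theta s) (PhiE w (q_T (D_E Dns)))//.
    by rewrite theta_ge0.
  have -> : Psi s (path_of B1 w) = 0 by exact: glue0.
  rewrite bigcupD in nD; rewrite (memNset nD) mulr0; by case: ifP.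
(* If the integral is infinite, both sides are 0 by the default of [fine]; the identity thus holds
   on every path. *)
by case: integral => [x| |] /=; rewrite ?gt0_muley ?gt0_muleNy ?lte_fin//= mulr0.
Qed.

Lemma transfer_control : exists2 beta',
  bounded_controls P2 (a ^+ 2 * T) B2 (c / (a * k)) beta' &
  ('N[P2]_+oo [EFin \o terminal_value (a ^+ 2 * T) B2 beta'] =
   a%:E * 'N[P1]_+oo [EFin \o terminal_value T B1 alpha])%E.
Proof.
exists beta; first by split; [exact: beta_pm|exact: beta_norm].
have -> : EFin \o terminal_value (a ^+ 2 * T) B2 beta = EFin \o (Y \o path_of
  (rescale a B2)).
  by apply/funext => w /=; rewrite Y2.
rewrite -(same_law_Lnormy (ltW T0) L1 L2 mY).
have -> : EFin \o (Y \o path_of B1) = EFin \o (fun w =>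
  a * terminal_value T B1 alpha w).
  by apply/funext => w /=; rewrite Y1.
by rewrite LnormyZ// ltW.
Qed.

End transfer.

(** * Measurability and pathwise integrability of controls *)

Section controls.
Context {R : realType} {d} {Omega : measurableType d}.
Variables (P : probability Omega R) (T : R) (B : R -> Omega -> R).
Hypotheses (T0 : 0 < T) (HB : brownian_motion P T B).

Let L : brownian_law P T B. Proof. by apply: brownian_motion_law => //;
  exact: ltW. Qed.

Lemma natural_sub_measurable t : t <= T ->
  natural_gen B t `<=` @measurable _ Omega.
Proof.
move=> tT _ [s /= + [U mU <-]]; rewrite in_itv /= => /andP[s0 st].
by apply: (law_measurable L) => //; exact: le_trans tT.
Qed.

Lemma measurable_to_natural t : t <= T ->
  @measurable_fun _ _ Omega (g_sigma_algebraType (natural_gen B t)) setT idfun.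
Proof.
move=> tT _ A mA; rewrite setTI.
by apply: (smallest_sub (@sigma_algebra_measurable _ Omega)
  (natural_sub_measurable tT)).
Qed.

Lemma control_measurable alpha : progressively_measurable T B alpha ->
  measurable_fun (`[0, T] `*` [set: Omega]) (fun x => alpha x.1 x.2).
Proof.
move=> pm; have := pm T (ltW T0) (lexx T).
move=> h; apply: (@measurable_comp _ _ _ _ _ _ _ (fun x : R *
  g_sigma_algebraType (natural_gen B T) => alpha x.1 x.2)
   _ (fun x : R * Omega =>
     (x.1, x.2 : g_sigma_algebraType (natural_gen B T)))) h _ => //.
- exact: measurableX.
- by move=> _ [[s w] [/= sT _] <-].
- apply: measurable_funTS; apply: measurable_fun_pair => //.
  exact: (measurableT_comp (measurable_to_natural (lexx T)) measurable_snd).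
Qed.

Lemma control_section_measurable alpha t : progressively_measurable T B alpha ->
  0 <= t -> t <= T -> measurable_fun setT (alpha t).
Proof.
move=> pm t0 tT.
apply: (@measurable_comp _ _ _ _ _ _ _ (fun x : R * Omega => alpha x.1 x.2)
   _ (fun w : Omega => (t, w))) (control_measurable pm) _ => //.
- exact: measurableX.
- by move=> _ [w _ <-]; split => //=; rewrite in_itv /= t0.
- exact: measurable_fun_pair.
Qed.

(** Since |x| <= 1 + x^2, the first absolute moment is at most 1 + c^2 at every time of [0, T];
    Fubini gives integrability on the product, hence on almost every path. *)
Lemma control_ae_integrable c alpha : 0 <= c -> bounded_controls P T B c alpha ->
  \forall w \ae P, lebesgue_measure.-integrable `[0, T] (fun s => (alpha s w)%:E).
Proof.
move=> c0 [pm Hc].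
have mDT : measurable (`[0, T] `*` [set: Omega]) by exact: measurableX.
pose f : R * Omega -> \bar R := (fun x =>
  (alpha x.1 x.2)%:E) \_ (`[0, T] `*` setT).
have mf : measurable_fun setT f.
  have /(measurable_restrictT _ mDT) : measurable_fun (`[0, T] `*` [set:
    Omega]) (fun x => (alpha x.1 x.2)%:E).
    by apply/measurable_EFinP; exact: control_measurable.
  by [].
have fE s w : f (s, w) = if s \in `[0, T]%classic then (alpha s w)%:E else 0%E.
  rewrite /f /patch; case: ifPn => [/set_mem[/= sT _]|nsT];
    first by rewrite mem_set.
  by rewrite ifF//; apply/negP => /set_mem sT; move/negP: nsT; apply;
    rewrite mem_set.
have fi : (lebesgue_measure \x P)%E.-integrable setT f.
  apply/integrable12ltyP => //.
  pose c2 := (1 + c ^+ 2)%:E : \bar R.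
  have intc2 : (\int[lebesgue_measure]_s (((cst c2) \_ `[0%R, T]) s) < +oo)%E.
    rewrite -integral_mkcond integral_cst//= lebesgue_measure_itv /= lte_fin T0.
    by rewrite oppr0 adde0 -EFinM ltry.
  apply: le_lt_trans intc2.
    apply: ge0_le_integral => //.
    - by move=> s _; apply: integral_ge0.
    - have maf : measurable_fun setT (fun x =>
        `|f x|)%E by exact: measurableT_comp.
      exact: (@measurable_fun_fubini_tonelli_F _ _ _ _ R P _ maf (fun=>
        abse_ge0 _)).
    - have /(measurable_restrictT _ _) : measurable_fun `[0, T] (cst c2 : R ->
        \bar R) by [].
      by apply.
    - move=> s _; under eq_integral do rewrite fE.
      rewrite /patch; case: ifPn => [/set_mem|_];
        last by rewrite integral0_eq// => w _; rewrite abse0.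
      rewrite /= in_itv /= => /andP[s0 sT].
      have ms := control_section_measurable pm s0 sT.
      apply: (@le_trans _ _ (\int[P]_w (1%:E + (alpha s w ^+ 2)%:E))%E).
        apply: ge0_le_integral => //.
        + by apply/measurable_EFinP; exact: measurableT_comp.
        + apply: emeasurable_funD => //; apply/measurable_EFinP.
          exact: measurable_funX.
        + move=> w _; rewrite -EFinD lee_fin -[alpha s w ^+ 2]real_normK
            ?num_real//.
          have := normr_ge0 (alpha s w); set x := `|_|; nra.
      rewrite ge0_integralD//; last 2 first.
        + by move=> w _; rewrite lee_fin sqr_ge0.
        + by apply/measurable_EFinP; exact: measurable_funX.
      rewrite integral_cst// mul1e /= (@probability_setT _ _ _ P) /c2 EFinD
        leeD2l//.
      by apply/Lnorm2_le => //; exact: Hc.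
have := ae_integrable2 fi; apply: filterS => w.
move=> h; apply/integrable_mkcond => //.
move: h; congr (_.-integrable _ _); apply/funext => s.
by rewrite fE /patch.
Qed.

End controls.

(** * Convex combinations of controls *)

Section convexity.
Context {R : realType} {d} {Omega : measurableType d}.
Variables (P : probability Omega R) (T : R) (B : R -> Omega -> R).
Hypotheses (T0 : 0 < T) (HB : brownian_motion P T B).

Lemma LnormyD (f g : Omega -> R) :
  ('N[P]_+oo [EFin \o (f \+ g)%R] <= 'N[P]_+oo [EFin \o f] + 'N[P]_+oo [EFin \o
    g])%E.
Proof.
rewrite unlock /Lnorm /= probability_setT lte01.
exact: (ess_sup_absD P (EFin \o f) (EFin \o g)).
Qed.

Lemma ae_eq_Lnormy (f g : Omega -> R) : (\forall w \ae P, f w = g w) ->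
  ('N[P]_+oo [EFin \o f] = 'N[P]_+oo [EFin \o g])%E.
Proof.
move=> fg; rewrite unlock /Lnorm /= probability_setT lte01.
by apply: eq_ess_sup; apply: filterS fg => w /= ->.
Qed.

Let conv (t : R) (alpha beta : R -> Omega -> R) : R -> Omega -> R :=
  fun s w => t * alpha s w + (1 - t) * beta s w.

Lemma bounded_controls_conv c1 c2 t alpha beta : 0 <= t -> t <= 1 ->
  bounded_controls P T B c1 alpha -> bounded_controls P T B c2 beta ->
  bounded_controls P T B (t * c1 + (1 - t) * c2) (conv t alpha beta).
Proof.
move=> t0 t1 [pa Ha] [pb Hb]; split.
  move=> s s0 sT; apply: measurable_funD.
    by apply: (measurable_funM (f := cst t)) => //; exact: pa.
  by apply: (measurable_funM (f := cst (1 - t))) => //; exact: pb.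
move=> s s0 sT.
have ma := control_section_measurable T0 HB pa s0 sT.
have mb := control_section_measurable T0 HB pb s0 sT.
rewrite [in leRHS]EFinD ![in leRHS]EFinM.
apply: (@le_trans _ _ ('N[P]_2%:E [EFin \o (fun w => t * alpha s w)%R] +
    'N[P]_2%:E [EFin \o (fun w => (1 - t) * beta s w)%R])%E).
  apply: (@eminkowski _ _ _ P (fun w => t * alpha s w) (fun w =>
    (1 - t) * beta s w)).
  - exact: (measurable_funM (f := cst t)).
  - exact: (measurable_funM (f := cst (1 - t))).
  - by rewrite lee_fin ler1n.
rewrite !Lnorm2Z ?subr_ge0//; apply: leeD; apply: lee_wpmul2l;
  rewrite ?lee_fin ?subr_ge0//; [exact: Ha|exact: Hb].
Qed.

(** The time integral is linear only where both paths are integrable; this holds almost everywhere,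
    which the essential supremum cannot distinguish. *)
Lemma terminal_value_conv c1 c2 t alpha beta : 0 <= c1 -> 0 <= c2 -> 0 <= t ->
  t <= 1 ->
  bounded_controls P T B c1 alpha -> bounded_controls P T B c2 beta ->
  ('N[P]_+oo [EFin \o terminal_value T B (conv t alpha beta)] <=
   t%:E * 'N[P]_+oo [EFin \o terminal_value T B alpha] +
   (1 - t)%:E * 'N[P]_+oo [EFin \o terminal_value T B beta])%E.
Proof.
move=> c10 c20 t0 t1 Ca Cb.
rewrite -!LnormyZ ?subr_ge0//.
rewrite (@ae_eq_Lnormy _ ((fun w => t * terminal_value T B alpha w) \+
   (fun w => (1 - t) * terminal_value T B beta w))); first exact: LnormyD.
have := control_ae_integrable T0 HB c10 Ca.
have := control_ae_integrable T0 HB c20 Cb.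
apply: filterS2 => w ib ia; rewrite /= /terminal_value /conv.
rewrite RintegralD//=; last 2 first.
- by apply: (@integrableZl _ _ _ _ _ _ t _ ia).
- by apply: (@integrableZl _ _ _ _ _ _ (1 - t) _ ib).
rewrite !RintegralZl//; ring.
Qed.

End convexity.

(** * The value as a function of the bound, and its convexity *)

Section value.
Context {R : realType} {d} {Omega : measurableType d}.
Variables (P : probability Omega R) (T : R) (B : R -> Omega -> R).
Hypotheses (T0 : 0 < T) (HB : brownian_motion P T B).

Definition value (c : R) : \bar R :=
  ereal_inf [set ('N[P]_+oo [EFin \o terminal_value T B alpha])%E
            | alpha in bounded_controls P T B c].

Lemma value_ge0 c : (0 <= value c)%E.
Proof. by apply: le_ereal_inf_tmp => _ [alpha _ <-]; exact: Lnorm_ge0. Qed.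

(** Mix e-optimal controls for the two bounds. Finiteness provides such controls, and the weights
    sum to 1, so the total error is e. *)
Lemma value_conv c1 c2 t : 0 <= c1 -> 0 <= c2 -> 0 <= t -> t <= 1 ->
  value c1 \is a fin_num -> value c2 \is a fin_num ->
  (value (t * c1 + (1 - t) * c2) <= t%:E * value c1 + (1 - t)%:E * value c2)%E.
Proof.
move=> c10 c20 t0 t1 f1 f2.
apply/lee_addgt0Pr => e e0.
have [_ [a Ca <-] Ha] := lb_ereal_inf_adherent e0 f1.
have [_ [b Cb <-] Hb] := lb_ereal_inf_adherent e0 f2.
apply: (@le_trans _ _ (t%:E * ('N[P]_+oo [EFin \o terminal_value T B a]) +
   (1 - t)%:E * ('N[P]_+oo [EFin \o terminal_value T B b]))%E).
  apply: ge_ereal_inf; eexists;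
    last exact: (terminal_value_conv T0 HB c10 c20 t0 t1 Ca Cb).
  by eexists; first exact: (bounded_controls_conv T0 HB t0 t1 Ca Cb).
have -> : (t%:E * value c1 + (1 - t)%:E * value c2 + e%:E =
   t%:E * (value c1 + e%:E) + (1 - t)%:E * (value c2 + e%:E))%E.
  rewrite -(fineK f1) -(fineK f2) -!EFinD; congr (_%:E); ring.
by apply: leeD; apply: lee_wpmul2l; rewrite ?lee_fin ?subr_ge0// ltW.
Qed.

End value.

(** * Comparison of values across horizons and probability spaces *)

Section value_transfer.
Context {R : realType} {d1 d2 : measure_display}.
Context {Omega1 : measurableType d1} {Omega2 : measurableType d2}.
Variables (P1 : probability Omega1 R) (P2 : probability Omega2 R).
Variables (B1 : R -> Omega1 -> R) (B2 : R -> Omega2 -> R).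

(** The strict inequality between the products leaves room for the factor 1/k lost by
    [transfer_control], applied with a = r2 / r1. *)
Lemma value_transfer (r1 r2 c1 c2 : R) : 0 < r1 -> 0 < r2 -> 0 <= c1 ->
  r1 * c1 < r2 * c2 ->
  brownian_motion P1 (r1 ^+ 2) B1 -> brownian_motion P2 (r2 ^+ 2) B2 ->
  (value P2 (r2 ^+ 2) B2 c2 <= (r2 / r1)%:E * value P1 (r1 ^+ 2) B1 c1)%E.
Proof.
move=> r10 r20 c10 c12 HB1 HB2.
have a0 : 0 < r2 / r1 by rewrite divr_gt0.
have c20 : 0 < c2.
  by rewrite -(pmulr_rgt0 _ r20) (le_lt_trans _ c12)// mulr_ge0// ltW.
(* The first term makes c1 / (a k) at most c2; the second keeps k positive when c1 = 0. *)
pose k := Num.max (r1 * c1 / (r2 * c2)) 2^-1.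
have k0 : 0 < k by rewrite lt_max invr_gt0 ltr0n orbT.
have k1 : k < 1.
  by rewrite gt_max ltr_pdivrMr ?mulr_gt0// mul1r c12 invf_lt1// ltr1n.
have T2E : r2 ^+ 2 = (r2 / r1) ^+ 2 * r1 ^+ 2.
  by rewrite -exprMn divfK ?gt_eqF.
rewrite T2E in HB2 *.
rewrite -lee_pdivrMl//.
apply: le_ereal_inf_tmp => _ [a Ca <-]; rewrite lee_pdivrMl//.
have r120 : 0 < r1 ^+ 2 by rewrite exprn_gt0.
have [b Cb <-] := transfer_control r120 a0 k0 k1 c10 HB1 HB2 Ca.
apply: ereal_inf_lbound; exists b => //; split; first exact: Cb.1.
move=> t t0 tT; apply: le_trans (Cb.2 t t0 tT) _.
have : r1 * c1 / (r2 * c2) <= k by rewrite le_max lexx.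
have a0k : 0 < r2 / r1 * k by rewrite mulr_gt0.
rewrite lee_fin (ler_pdivrMr _ _ a0k) ler_pdivrMr ?mulr_gt0// => h.
have -> : c2 * (r2 / r1 * k) = k * (r2 * c2) / r1 by ring.
by rewrite ler_pdivlMr// mulrC.
Qed.

End value_transfer.

(** * A sixth moment bound for the centered normal law *)

Section normal_moment.
Context {R : realType}.
Import HBNNSimple.
Let mu := @lebesgue_measure R.
Local Open Scope ereal_scope.

Let integral_normal_nnsfun (s : R) (h : {nnsfun (measurableTypeR R) >-> R}) :
  \int[normal_prob 0 s]_x (h x)%:E = \int[mu]_x ((h x)%:E * (normal_pdf 0 s
    x)%:E).
Proof.
under [LHS]eq_integral do rewrite fimfunE -fsumEFin//.
rewrite [LHS]ge0_integral_fsum//; last 2 first.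
  - by move=> r; apply/measurable_EFinP; do 2 apply/measurableT_comp => //.
  - by move=> n x _; rewrite EFinM nnfun_muleindic_ge0.
under [RHS]eq_integral => x _.
  rewrite fimfunE -fsumEFin// ge0_mule_fsuml; last first.
    by move=> r; rewrite EFinM nnfun_muleindic_ge0.
  over.
have mpdf : measurable_fun setT (fun x : R => (normal_pdf 0 s x)%:E).
  by apply/measurable_EFinP; exact: measurable_normal_pdf.
rewrite [RHS]ge0_integral_fsum//; last 2 first.
  - move=> r; apply: emeasurable_funM => //;
      exact/measurable_EFinP/measurableT_comp.
  - move=> n x _; rewrite mule_ge0//; first by rewrite EFinM nnfun_muleindic_ge0.
    by rewrite lee_fin normal_pdf_ge0.
apply: eq_fsbigr => r /set_mem [x _ hxr].
have r0 : (0 <= r)%R by rewrite -hxr.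
rewrite integralZl_indic_nnsfun//= integral_indic//= setIT /normal_prob.
rewrite -ge0_integralZl_EFin//; last 2 first.
  - by move=> y _; rewrite lee_fin normal_pdf_ge0.
  - exact: measurable_funTS.
rewrite integral_mkcond; apply: eq_integral => y _.
rewrite patchE indicE; case: ifPn => _ /=; first by rewrite mulr1.
by rewrite mulr0 mul0e.
Qed.

(** Simple functions approximating f from below satisfy the density formula and stay below f;
    monotone convergence on the left-hand side alone gives the inequality, which is enough for a
    moment bound. *)
Lemma integral_normal_prob_le (s : R) (f : measurableTypeR R -> \bar R) :
  measurable_fun setT f ->
  (forall x, 0 <= f x) ->
  \int[normal_prob 0 s]_x f x <= \int[mu]_x (f x * (normal_pdf 0 s x)%:E).
Proof.
move=> mf f0.
have mpdf : measurable_fun setT (fun x : R => (normal_pdf 0 s x)%:E).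
  by apply/measurable_EFinP; exact: measurable_normal_pdf.
pose f_ := nnsfun_approx measurableT mf.
have fE : \int[normal_prob 0 s]_x f x = limn (fun n =>
  \int[normal_prob 0 s]_x (f_ n x)%:E).
  rewrite -monotone_convergence//=.
  - by apply: eq_integral => x _; apply/esym/cvg_lim => //;
      exact: cvg_nnsfun_approx.
  - by move=> n; apply/measurable_EFinP; exact: measurable_funTS.
  - by move=> n x _; rewrite lee_fin.
  - by move=> x _ a b ab; rewrite lee_fin//; exact/lefP/nd_nnsfun_approx.
rewrite fE; apply: lime_le.
  apply: ereal_nondecreasing_is_cvgn => a b ab; apply: ge0_le_integral => //.
  - by move=> x _; rewrite lee_fin.
  - by apply/measurable_EFinP; exact: measurable_funTS.
  - by apply/measurable_EFinP; exact: measurable_funTS.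
  - by move=> x _; rewrite lee_fin//; exact/lefP/nd_nnsfun_approx.
apply: nearW => n; rewrite integral_normal_nnsfun; apply: ge0_le_integral => //.
- by move=> x _; rewrite mule_ge0// lee_fin// normal_pdf_ge0.
- by apply: emeasurable_funM => //; apply/measurable_EFinP;
    exact: measurable_funTS.
- exact: emeasurable_funM.
- move=> x _; apply: lee_wpmul2r; first by rewrite lee_fin normal_pdf_ge0.
  rewrite nnsfun_approxE; exact: le_approx.
Qed.

(** Pointwise, x^6 times the density of deviation s is at most 256 s^6 times the density of
    deviation 2 s, whose integral is 1. *)
Lemma normal_prob_moment6 (s : R) : (0 < s)%R ->
  \int[normal_prob 0 s]_x (x ^+ 6)%:E <= (256 * s ^+ 6)%:E.
Proof.
move=> s0.
have mX : measurable_fun setT (fun x : R => (x ^+ 6)%:E).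
  by apply/measurable_EFinP; exact: exprn_measurable.
have mpdf t : measurable_fun setT (fun x : R => (normal_pdf 0 t x)%:E).
  by apply/measurable_EFinP; exact: measurable_normal_pdf.
apply: (le_trans (integral_normal_prob_le s mX _)).
  by move=> x; rewrite lee_fin (exprM _ 2 3) exprn_ge0// sqr_ge0.
have C0 : (0 <= 256 * s ^+ 6)%R by rewrite mulr_ge0// exprn_ge0// ltW.
have -> : (256 * s ^+ 6)%:E =
    \int[mu]_x ((256 * s ^+ 6)%:E * (normal_pdf 0 (2 * s) x)%:E).
  rewrite ge0_integralZl_EFin//.
  - by rewrite integral_normal_pdf mule1.
  - by move=> x _; rewrite lee_fin normal_pdf_ge0.
  - exact: mpdf.
apply: ge0_le_integral => //.
- by move=> x _; rewrite mule_ge0// lee_fin ?normal_pdf_ge0// (exprM _ 2 3)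
    exprn_ge0// sqr_ge0.
- by apply: emeasurable_funM; [exact: mX|exact: mpdf].
- by apply: emeasurable_funM => //; exact: mpdf.
move=> x _; rewrite -!EFinM lee_fin !normal_pdfE ?gt_eqF ?mulr_gt0//.
have -> : (normal_peak (2 * s) = 2^-1 * normal_peak s)%R.
  rewrite /normal_peak exprMn -mulrA -mulrnAr sqrtrM ?sqr_ge0// invfM.
  by rewrite sqrtr_sqr ger0_norm.
rewrite /normal_fun !subr0.
pose u := (x ^+ 2 / s ^+ 2)%R.
have u0 : (0 <= u)%R by rewrite divr_ge0 ?sqr_ge0.
(* The part u / 8 is the exponent for deviation 2 s; the remaining 3 u / 8 has to absorb the
   polynomial. *)
have -> : (- x ^+ 2 / (s ^+ 2 *+ 2) = - ((3 / 8) * u) + - (u / 8))%R.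
  by rewrite /u; field; rewrite gt_eqF.
have -> : (- x ^+ 2 / ((2 * s) ^+ 2 *+ 2) = - (u / 8))%R.
  by rewrite /u; field; rewrite gt_eqF.
rewrite expRD (expRN (3 / 8 * u)).
have v0 : (0 <= 3 / 8 * u)%R by rewrite mulr_ge0.
have := expR_ge1Dxn 2 v0; set e := expR _ => He.
have e0 : (0 < e)%R by exact: expR_gt0.
have -> : (x ^+ 6 = s ^+ 6 * u ^+ 3)%R.
  by rewrite /u; field; rewrite gt_eqF.
(* The cubic term of the exponential at 3 u / 8 is 9 u^3 / 1024, and 128 * 9 / 1024 >= 1. The ratio
   2 of the peaks turns 128 into 256. *)
have key : (u ^+ 3 <= 128 * e)%R.
  apply: le_trans (ler_wpM2l _ He) => //.
  have : (0 <= u ^+ 3)%R by rewrite exprn_ge0.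
  have -> : ((3 / 8 * u) ^+ 3 / 3`!%:R = u ^+ 3 * (9 / 1024) :> R)%R.
    by rewrite (_ : 3`! = 6)%N//; field.
  set w := (u ^+ 3)%R; lra.
set q := expR _.
have q0 : (0 <= q)%R by exact: expR_ge0.
rewrite [leRHS](_ : _ = ((128 * e) * (s ^+ 6 * (normal_peak s * (e^-1 *
  q))))%R); last first.
  by field; rewrite gt_eqF.
rewrite [leLHS](_ : _ = (u ^+ 3 * (s ^+ 6 * (normal_peak s * (e^-1 * q))))%R);
  last by ring.
apply: ler_wpM2r => //.
by rewrite !mulr_ge0 ?normal_peak_ge0 ?invr_ge0 ?exprn_ge0// ltW.
Qed.
End normal_moment.

(** * Finiteness of the value for every positive bound *)

Section finiteness.
Context {R : realType} {d} {Omega : measurableType d}.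
Variables (P : probability Omega R) (T : R) (B : R -> Omega -> R) (c : R).
Hypotheses (T0 : 0 < T) (HB : brownian_motion P T B) (c0 : 0 < c).

(* Since the excess of Z k over m k is at most |Z k| ^ 3 / (m k) ^ 2, the sixth
   moment of Z k shows that the control A has a second moment of order
   T / M ^ 4 uniformly in k. *)
Let t_ k : R := T * (1 - 16^-1 ^+ k).
Let del k : R := T * 16^-1 ^+ k * (15 / 16).
Let Z k w : R := B (t_ k.+1) w - B (t_ k) w.
Let M : R := 1 + 256 * 240 * T / c ^+ 2.
Let m k : R := M * 2^-1 ^+ k.
Let clip (a x : R) : R := Num.max (- a) (Num.min a x).
Let A n w : R := if n is k.+1 then - (Z k w - clip (m k) (Z k w)) / del k.+1
  else 0.
Let I n : set R := `]t_ n, t_ n.+1].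
Let alpha : R -> Omega -> R := glue I (fun n _ w => A n w).

Let e0 k : 0 < 16^-1 ^+ k :> R. Proof. by rewrite exprn_gt0// invr_gt0. Qed.
Let del0 k : 0 < del k. Proof. by rewrite !mulr_gt0. Qed.
Let delE k : t_ k.+1 - t_ k = del k.
Proof. by rewrite /t_ /del exprS; move: (_ ^+ k) => e; field. Qed.
Let t_lt k : t_ k < t_ k.+1. Proof. by rewrite -subr_gt0 delE. Qed.
Let t_0 : t_ 0 = 0. Proof. by rewrite /t_ expr0 subrr mulr0. Qed.
Let t_le i j : (i <= j)%N -> t_ i <= t_ j.
Proof.
move=> ij; rewrite /t_ ler_pM2l// lerD2l lerN2.
by apply: ler_wiXn2l => //; rewrite ?invr_ge0// invf_le1// ler1n.
Qed.
Let t_ge0 k : 0 <= t_ k. Proof. by rewrite -t_0 t_le. Qed.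
Let t_ltT k : t_ k < T.
Proof. by rewrite /t_ gtr_pMr// ltrBlDr ltrDl. Qed.
Let M1 : 1 <= M.
Proof. by rewrite lerDl divr_ge0 ?sqr_ge0// mulr_ge0// ltW. Qed.
Let M0 : 0 < M. Proof. exact: lt_le_trans M1. Qed.
Let m0 k : 0 < m k. Proof. by rewrite mulr_gt0// exprn_gt0// invr_gt0. Qed.

Let clip_le (a x : R) : 0 <= a -> `|clip a x| <= a.
Proof.
move=> a0; rewrite ler_norml /clip le_max lexx/= ge_max ge_min lexx andbT.
by rewrite -subr_ge0 opprK addr_ge0.
Qed.

(** If |x| <= a the excess is 0; otherwise it is |x| - a <= |x|, and a <= |x| bounds the other four
    factors. *)
Let excess_le (a x : R) : 0 < a -> (x - clip a x) ^+ 2 * a ^+ 4 <= x ^+ 6.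
Proof.
move=> a0; rewrite /clip.
have x6 y : a <= y -> (y - a) ^+ 2 * a ^+ 4 <= y ^+ 6.
  move=> ay; rewrite (_ : 6 = 2 + 4)%N// exprD.
  by apply: ler_pM; rewrite ?sqr_ge0// ?exprn_ge0 ?ler_pXn2r ?nnegrE
    ?subr_ge0// ?ltW//; lra.
have [ax|xa] := leP a x.
  by rewrite max_r; [exact: x6|lra].
have [xa'|ax'] := leP x (- a).
  have -> : (x - - a) ^+ 2 = (- x - a) ^+ 2 by ring.
  have -> : x ^+ 6 = (- x) ^+ 6 by ring.
  by apply: x6; lra.
rewrite subrr expr0n/= mul0r (_ : x ^+ 6 = (x ^+ 3) ^+ 2) ?sqr_ge0//.
by rewrite -exprM.
Qed.

Let mI n : measurable (I n). Proof. exact: measurable_itv. Qed.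

Let tI : trivIset setT I.
Proof.
move=> i j _ _ [s []]; rewrite /I /= !in_itv /= => /andP[is1 is2] /andP[js1 js2].
apply/eqP; rewrite eqn_leq; apply/andP; split; rewrite leqNgt; apply/negP => ij.
  have := t_le ij; rewrite leNgt => /negP; apply; exact: lt_le_trans js2.
have := t_le ij; rewrite leNgt => /negP; apply; exact: lt_le_trans is2.
Qed.

Let L : brownian_law P T B. Proof. by apply: brownian_motion_law => //;
  exact: ltW. Qed.

Let mclip a : measurable_fun setT (clip a).
Proof. by apply: measurable_maxr => //; exact: measurable_minr. Qed.

Let measurable_A {d'} {X : measurableType d'} (f : X -> Omega) n :
  (forall k, (k <= n)%N -> measurable_fun setT (fun x => B (t_ k) (f x))) ->
  measurable_fun setT (fun x => A n (f x)).
Proof.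
case: n => [|n] mf //=; rewrite /A.
have mZ : measurable_fun setT (fun x => Z n (f x)).
  by apply: measurable_funB; apply: mf.
apply: measurable_funM => //; apply: measurable_funN.
by apply: measurable_funB => //; exact: (measurableT_comp (mclip (m n))).
Qed.

(** On the left-open interval [I n] the control [A n] uses B only at grid times up to [t_ n], which
    lie before the current time. *)
Let alpha_pm : progressively_measurable T B alpha.
Proof.
move=> t t0 tT.
apply: (@measurable_glue _ _ (g_sigma_algebraType (natural_gen B t)) I (fun n _
  w => A n w)) => // n.
have [[s [/= st Is]]|nI] := pselect (exists s, (`[0, t] `&` I n) s); last first.
  rewrite (_ : _ `*` _ = set0); first exact: measurable_fun_set0.
  by apply/seteqP; split => // -[s x] [Hs _]; apply: nI; exists s.
apply: measurable_funTS.
have := @measurable_A _ (R * g_sigma_algebraType (natural_gen B t))%type snd n.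
apply => k kn.
apply: (@measurableT_comp _ _ _ _ (g_sigma_algebraType (natural_gen B t)) _ (B
  (t_ k)) _ snd) => //.
move=> _ U mU; apply: sub_sigma_algebra; exists (t_ k); last by exists U.
move: st Is; rewrite /= !in_itv /= t_ge0 => /andP[_ st] /andP[ns _] /=.
by rewrite (le_trans (t_le kn))// (le_trans _ st)// ltW.
Qed.

Let mA n : measurable_fun setT (A n).
Proof.
apply: (@measurable_A _ Omega idfun) => k _.
by apply: (law_measurable L) => //; exact: ltW.
Qed.

Let A_norm n : (\int[P]_w ((A n w) ^+ 2)%:E <= (c ^+ 2)%:E)%E.
Proof.
case: n => [|k].
  rewrite integral0_eq ?lee_fin ?sqr_ge0// => w _.
  by rewrite /= expr0n.
have mZ : measurable_fun setT (Z k).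
  by apply: measurable_funB; apply: (law_measurable L) => //; exact: ltW.
pose K := (m k ^+ 4 * del k.+1 ^+ 2)^-1.
have K0 : 0 <= K by rewrite invr_ge0 mulr_ge0 ?sqr_ge0// exprn_ge0// ltW.
have mX : measurable_fun setT (fun x : measurableTypeR R => (x ^+ 6)%:E).
  by apply/measurable_EFinP; exact: exprn_measurable.
have X0 (x : R) : (0 <= (x ^+ 6)%:E)%E.
  by rewrite lee_fin (exprM _ 2 3) exprn_ge0// sqr_ge0.
have ms : 0 < Num.sqrt (del k) by rewrite sqrtr_gt0.
have EZ : (\int[P]_w ((Z k w) ^+ 6)%:E <= (256 * (Num.sqrt (del k)) ^+ 6)%:E)%E.
  apply: le_trans (normal_prob_moment6 ms).
  have := @ge0_integral_pushforward _ _ _ (measurableTypeR R) R (Z k) mZ P setT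
    _ measurableT mX (fun x _ => X0 x).
  rewrite preimage_setT => <-; rewrite le_eqVlt; apply/orP; left; apply/eqP.
  apply: eq_measure_integral => U mU _.
  have tT : t_ k.+1 <= T by exact: ltW.
  by rewrite -delE; apply: (brownian_normal_incr HB (t_ge0 k) (t_lt k) tT mU).
apply: (@le_trans _ _ (\int[P]_w (K%:E * ((Z k w) ^+ 6)%:E))%E).
  apply: ge0_le_integral => //.
  - by move=> w _; rewrite lee_fin sqr_ge0.
  - by apply/measurable_EFinP; apply: measurable_funX; exact: mA.
  - apply: emeasurable_funM => //; apply/measurable_EFinP; exact: measurable_funX.
  - move=> w _; rewrite -EFinM lee_fin /= /K.
    have E (a D e : R) : D != 0 -> a * D ^+ 2 * ((- e / D) ^+ 2) = e ^+ 2 * a.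
      by move=> D0; field.
    rewrite ler_pdivlMl ?mulr_gt0 ?exprn_gt0// E ?gt_eqF//.
    exact: excess_le.
rewrite ge0_integralZl_EFin//; last by apply/measurable_EFinP;
  exact: measurable_funX.
apply: le_trans (lee_wpmul2l _ EZ) _; first by rewrite lee_fin.
rewrite -EFinM lee_fin (exprM _ 2 3) sqr_sqrtr ?(ltW (del0 k))//.
(* As (1/2)^4 = 1/16, the powers of 16 coming from [m k], [del k.+1] and [del k] cancel; 240 is
   (15/16) * 16^2. *)
have -> : K * (256 * del k ^+ 3) = 256 * 240 * T / M ^+ 4.
  have m4 : m k ^+ 4 = M ^+ 4 * 16^-1 ^+ k.
    have <- : 2^-1 ^+ 4 = 16^-1 :> R by field.
    by rewrite /m exprMn -!exprM mulnC.
  rewrite /K m4 /del (exprS _ k); move: (e0 k); move: (_ ^+ k) => e e_gt0.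
  by field; rewrite !gt_eqF.
have c20 : 0 < c ^+ 2 by rewrite exprn_gt0.
rewrite ler_pdivrMr ?exprn_gt0// -ler_pdivrMl// [leLHS]mulrC.
(* The second summand of M is the required lower bound for M^4; the summand 1 ensures M <= M^4. *)
apply: (@le_trans _ _ M); first by rewrite /M lerDr.
by rewrite ler_eXnr.
Qed.

Let alpha_bounded : bounded_controls P T B c alpha.
Proof.
split; first exact: alpha_pm.
move=> s s0 sT; apply/(Lnorm2_le P (alpha s) (ltW c0)).
have [[n _ Is]|nI] := pselect ((\bigcup_n I n) s).
  rewrite (eq_integral (fun w => (A n w ^+ 2)%:E)); first exact: A_norm.
  by move=> w _; rewrite /alpha (glueE _ _ tI Is).
rewrite integral0_eq ?lee_fin ?sqr_ge0// => w _.
by rewrite /alpha glue0// expr0n.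
Qed.

Let cvg_t : t_ n @[n --> \oo] --> T.
Proof.
rewrite -[X in _ --> X](_ : T * (1 - 0) = T); last by rewrite subr0 mulr1.
apply: cvgM; first exact: cvg_cst.
apply: cvgB; first exact: cvg_cst.
by apply: cvg_expr; rewrite ger0_norm ?invr_ge0// invf_lt1// ltr1n.
Qed.

(** The control integral runs one grid step ahead of B: after compensation, the increment [Z j]
    contributes only its clipped part, at most [m j], and these sum over j < n to 2 M - 2 m n. *)
Let terminal_bounded w : {within `[0, T], continuous (fun t => B t w)} ->
  B 0 w = 0 -> lebesgue_measure.-integrable `[0, T] (fun s => (alpha s w)%:E) ->
  `|terminal_value T B alpha w| <= 2 * M.
Proof.
move=> cB B0 ia.
pose J n : R := \int[lebesgue_measure]_(s in `[0, t_ n]) alpha s w.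
have J0 : J 0%N = 0 by rewrite /J t_0 set_itv1 Rintegral_set1.
have JS n : J n.+1 = J n + A n w * del n.
  apply/eqP; rewrite addrC -subr_eq; apply/eqP; rewrite /J.
  rewrite Rintegral_itvB ?bnd_simp ?t_ge0//; last 2 first.
  - apply: integrableS ia => // s /=;
      rewrite !in_itv /= => /andP[-> /le_trans]; apply; exact: ltW.
  - by rewrite ltW.
  rewrite (@eq_Rintegral _ _ _ _ _ (fun=> A n w)); last first.
    by move=> s /set_mem Is; rewrite /alpha (glueE _ _ tI Is).
  rewrite Rintegral_cst//= lebesgue_measure_itv /= lte_fin t_lt.
  by rewrite /= delE.
have Sn n : `|J n.+1 + B (t_ n) w| <= 2 * M - 2 * m n.
  elim: n => [|n IH].
    by rewrite JS J0 t_0 B0 /A mul0r !addr0 normr0 /m expr0 mulr1 subrr.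
  rewrite JS.
  have -> : J n.+1 + A n.+1 w * del n.+1 + B (t_ n.+1) w =
     J n.+1 + B (t_ n) w + clip (m n) (Z n w).
    by rewrite /A mulrVK ?unitfE ?gt_eqF// /Z; ring.
  apply: (le_trans (ler_normD _ _)).
  apply: (le_trans (lerD IH (clip_le _ (ltW (m0 n))))).
  by rewrite (_ : m n.+1 = m n / 2); [lra|rewrite /m exprSr mulrA].
(* The shift between the two grid times disappears in the limit, since the integral and the Brownian
   path are both left-continuous at T. *)
have cJ : J n.+1 @[n --> \oo] --> \int[lebesgue_measure]_(s in `[0, T]) alpha s w.
  apply: (cvg_at_leftP _ _ _).1 (parameterized_integral_cvg_at_left T0 ia) _ _.
  by split=> // ; rewrite (cvg_shiftS t_).
have cBT : B (t_ n) w @[n --> \oo] --> B T w.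
  have [_ _ cl] := (continuous_within_itvP _ T0).1 cB.
  exact: (cvg_at_leftP _ _ _).1 cl _ _.
have cS : J n.+1 + B (t_ n) w @[n --> \oo] --> terminal_value T B alpha w
  by exact: cvgD.
have cN : `|J n.+1 + B (t_ n) w| @[n --> \oo] --> `|terminal_value T B alpha w|.
  exact: cvg_norm.
rewrite -(cvg_lim _ cN)//; apply: limr_le.
  by apply/cvg_ex; eexists; exact: cN.
by apply: nearW => n; rewrite (le_trans (Sn n))// gerBl mulr_ge0// ltW.
Qed.

Lemma value_fin_num : value P T B c \is a fin_num.
Proof.
rewrite ge0_fin_numE ?value_ge0//.
apply: (@le_lt_trans _ _ (2 * M)%:E); last by rewrite ltry.
apply: ge_ereal_inf; eexists; first by exists alpha; first exact: alpha_bounded.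
rewrite unlock /Lnorm /= probability_setT lte01.
apply/ess_supP.
have := control_ae_integrable T0 HB (ltW c0) alpha_bounded.
have := brownian_start HB.
have := brownian_continuous HB.
apply: filterS3 => w cB B0 ia /=.
by rewrite lee_fin; exact: terminal_bounded.
Qed.

End finiteness.

(** * Continuity of nonnegative nonincreasing convex functions *)

Section nonincreasing_convex.
Context {R : realType}.
Variable f : R -> R.
Hypothesis f_ge0 : forall x : R, 0 < x -> 0 <= f x.
Hypothesis f_nincr : forall x y : R, 0 < x -> x <= y -> f y <= f x.
Hypothesis f_conv : forall t x y : R, 0 <= t -> t <= 1 -> 0 < x -> 0 < y ->
  f (t * x + (1 - t) * y) <= t * f x + (1 - t) * f y.

Lemma nonincreasing_convex_continuous (x : R) : 0 < x -> f y @[y --> x] --> f x.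
Proof.
move=> x0; have x20 : 0 < x / 2 by rewrite divr_gt0.
(* A Lipschitz constant relative to x: nonnegativity of f bounds by f (x / 2) / (x / 2) the slopes
   of the chords considered. *)
pose L := f (x / 2) * (2 / x).
have L0 : 0 <= L by rewrite mulr_ge0 ?f_ge0// divr_ge0// ltW.
have lip y : x / 2 < y -> `|f x - f y| <= L * `|x - y|.
  move=> xy; have y0 : 0 < y by exact: lt_trans xy.
  have [yx|xy'] := leP y x.
    rewrite distrC ger0_norm ?subr_ge0 ?f_nincr// ger0_norm ?subr_ge0//.
    pose u := (x - y) * (2 / x).
    have u0 : 0 <= u by rewrite mulr_ge0 ?subr_ge0 ?divr_ge0// ltW.
    have u1 : u <= 1 by rewrite /u mulrA ler_pdivrMr// mul1r; lra.
    have := f_conv u0 u1 x20 x0.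
    have -> : u * (x / 2) + (1 - u) * x = y by rewrite /u; field; rewrite gt_eqF.
    have -> : L * (x - y) = u * f (x / 2) by rewrite /L /u; ring.
    have := mulr_ge0 u0 (f_ge0 x0); lra.
  rewrite ger0_norm ?subr_ge0 ?f_nincr// ?(ltW xy')// ltr0_norm ?subr_lt0// opprB.
  have yx20 : 0 < y - x / 2 by rewrite subr_gt0.
  (* Now x is the combination of x / 2 and y; since y - x / 2 >= x / 2, the same constant L
     serves. *)
  pose u := (y - x) / (y - x / 2).
  have u0 : 0 <= u by rewrite divr_ge0 ?subr_ge0// ltW.
  have u1 : u <= 1 by rewrite ler_pdivrMr// mul1r; lra.
  have := f_conv u0 u1 x20 y0.
  have -> : u * (x / 2) + (1 - u) * y = x by rewrite /u; field;
    rewrite gt_eqF//; lra.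
  have uL : u * f (x / 2) <= L * (y - x).
    rewrite /L -mulrA [leLHS]mulrC; apply: ler_wpM2l; first exact: f_ge0.
    rewrite /u [leRHS]mulrC; apply: ler_wpM2l; first by rewrite subr_ge0 ltW.
    by rewrite -[2 / x]invf_div lef_pV2 ?posrE//; lra.
  have := mulr_ge0 u0 (f_ge0 y0); lra.
apply/cvgrPdist_le => e e0.
near=> y.
have xy : x / 2 < y.
  near: y; apply: lt_nbhsr; lra.
apply: le_trans (lip _ xy) _.
have : `|x - y| <= e / (L + 1).
  near: y; apply: cvgr_dist_le => //; last first.
    by rewrite divr_gt0// ltr_wpDl.
rewrite ler_pdivlMr ?ltr_wpDl//.
have := normr_ge0 (x - y); lra.
Unshelve. all: end_near. Qed.
End nonincreasing_convex.

(** * Monotonicity, convexity and continuity of the normalized value *)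

Section normalized_value.
Context {R : realType}.
Variables (d : R -> measure_display) (Omega : forall T : R, measurableType (d T)).
Variables (P : forall T : R, probability (Omega T) R).
Variables (B : forall T : R, R -> Omega T -> R) (c : R).
Hypotheses (HB : forall T : R, 0 < T -> brownian_motion (P T) T (@B T)) (c0 : 0
  < c).

Let V (T k : R) : \bar R := value (P T) T (@B T) k.
Let f (r : R) : R := r^-1 * fine (V (r ^+ 2) c).

Let V_fin T k : 0 < T -> 0 < k -> V T k \is a fin_num.
Proof. by move=> T0 k0; exact: value_fin_num (HB T0) k0. Qed.

Let sq0 (r : R) : 0 < r -> 0 < r ^+ 2. Proof. by move=> ?; exact: exprn_gt0. Qed.

Let transfer r s k : 0 < r -> 0 < s -> r * c < s * k ->
  fine (V (s ^+ 2) k) <= s * f r.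
Proof.
move=> r0 s0 rs.
have k0 : 0 < k by rewrite -(pmulr_rgt0 _ s0) (lt_trans _ rs)// mulr_gt0.
have := value_transfer r0 s0 (ltW c0) rs (HB (sq0 r0)) (HB (sq0 s0)).
rewrite -/(V (s ^+ 2) k) -/(V (r ^+ 2) c).
rewrite -(fineK (V_fin (sq0 s0) k0)) -(fineK (V_fin (sq0 r0) c0)) -EFinM lee_fin.
by rewrite /f mulrA.
Qed.

Lemma normalized_value_ge0 r : 0 < r -> 0 <= f r.
Proof.
by move=> r0; rewrite mulr_ge0 ?invr_ge0 ?(ltW r0)// fine_ge0// value_ge0.
Qed.

(** For r < s the products r c and s c differ strictly, so [transfer] applies with the same bound c
    at both horizons. *)
Lemma normalized_value_nincr r s : 0 < r -> r <= s -> f s <= f r.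
Proof.
move=> r0; rewrite le_eqVlt => /predU1P[->//|rs].
have s0 : 0 < s by exact: lt_trans rs.
by rewrite /f ler_pdivrMl//; apply: transfer => //; rewrite ltr_pM2r.
Qed.

(** Both values are moved to the common horizon m^2, at bounds nearly proportional to a and b, where
    convexity in the bound applies. *)
Lemma normalized_value_conv t a b : 0 <= t -> t <= 1 -> 0 < a -> 0 < b ->
  f (t * a + (1 - t) * b) <= t * f a + (1 - t) * f b.
Proof.
move=> t0 t1 a0 b0; set m := t * a + (1 - t) * b.
have t1' : 0 <= 1 - t by rewrite subr_ge0.
have m_gt0 : 0 < m.
  have [t00|tN0] := eqVneq t 0; first by rewrite /m t00 mul0r add0r subr0 mul1r.
  apply: ltr_pwDl; first by rewrite mulr_gt0// lt_neqAle eq_sym tN0.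
  by rewrite mulr_ge0// ltW.
set F := t * f a + (1 - t) * f b.
have V0 k : 0 <= fine (V (m ^+ 2) k) by rewrite fine_ge0// value_ge0.
have conv k1 k2 u : 0 < k1 -> 0 < k2 -> 0 <= u -> u <= 1 ->
    fine (V (m ^+ 2) (u * k1 + (1 - u) * k2)) <=
    u * fine (V (m ^+ 2) k1) + (1 - u) * fine (V (m ^+ 2) k2).
  move=> k10 k20 u0 u1.
  have F1 := V_fin (sq0 m_gt0) k10; have F2 := V_fin (sq0 m_gt0) k20.
  have := value_conv (sq0 m_gt0) (HB (sq0 m_gt0)) (ltW k10) (ltW k20) u0 u1 F1 F2.
  rewrite -[X in (X <= _)%E]fineK; last first.
    apply: V_fin; first exact: sq0.
    have [->|uN0] := eqVneq u 0; first by rewrite mul0r add0r subr0 mul1r.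
    apply: ltr_pwDl; first by rewrite mulr_gt0// lt_neqAle eq_sym uN0.
    by rewrite mulr_ge0 ?subr_ge0// ltW.
  rewrite -/(V _ k1) -/(V _ k2) -(fineK F1) -(fineK F2) -!EFinM -EFinD lee_fin.
  by [].
have step1 e : 0 < e -> fine (V (m ^+ 2) (c * (1 + e))) <= m * F.
  move=> e0.
  (* The factor 1 + e gives the strict inequality x c < m k x needed by [transfer]; the average of
     the two bounds is c (1 + e). *)
  pose k x := x * c * (1 + e) / m.
  have k0 x : 0 < x -> 0 < k x by move=> x0;
    rewrite divr_gt0// !mulr_gt0// addr_gt0.
  have kT x : 0 < x -> fine (V (m ^+ 2) (k x)) <= m * f x.
    move=> x0; apply: transfer => //.
    rewrite /k [ltRHS]mulrC divfK ?gt_eqF// ltr_pMr ?mulr_gt0//; lra.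
  have -> : c * (1 + e) = t * k a + (1 - t) * k b.
    rewrite [RHS](_ : _ = (t * a + (1 - t) * b) * (c * (1 + e)) / m);
      last by rewrite /k; ring.
    by rewrite -/m mulrAC mulfV ?mul1r// gt_eqF.
  apply: (le_trans (conv _ _ _ (k0 _ a0) (k0 _ b0) t0 t1)).
  have -> : m * F = t * (m * f a) + (1 - t) * (m * f b) by rewrite /F; ring.
  by apply: lerD; apply: ler_wpM2l => //; exact: kT.
rewrite /f ler_pdivrMl//.
apply/ler_addgt0Pr => eps eps0.
(* c lies between c / 2 and c (1 + e): convexity lets e tend to 0. *)
pose K := fine (V (m ^+ 2) (c / 2)).
have K0 : 0 <= K := V0 _.
(* The weight u of c / 2 is at most 2 e, so its contribution u K stays below eps. *)
pose e := eps / (2 * (K + 1)).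
have e0 : 0 < e by rewrite divr_gt0// mulr_gt0// ltr_wpDl.
pose u := e / (2^-1 + e).
have d0 : 0 < 2^-1 + e by rewrite addr_gt0.
have u0 : 0 <= u by rewrite divr_ge0 ?ltW.
have u1 : u <= 1 by rewrite ler_pdivrMr// mul1r lerDr.
have cE : c = u * (c / 2) + (1 - u) * (c * (1 + e)).
  rewrite /u; field; lra.
rewrite [in leLHS]cE.
apply: (le_trans (conv _ _ _ _ _ u0 u1)).
- by rewrite divr_gt0.
- by rewrite mulr_gt0// addr_gt0.
have := step1 e e0; rewrite -/K; set W := fine _ => WF.
have W0 : 0 <= W by exact: V0.
have ue : u <= 2 * e.
  rewrite ler_pdivrMr// [leRHS](_ : _ = e + 2 * e ^+ 2); last by field.
  by rewrite lerDl mulr_ge0 ?sqr_ge0.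
have uK : u * K <= eps.
  apply: (@le_trans _ _ (2 * e * K)); first exact: ler_wpM2r.
  rewrite (_ : 2 * e * K = eps * (K / (K + 1))); last first.
    by rewrite /e; field; lra.
  rewrite ler_piMr ?(ltW eps0)// ler_pdivrMr ?ltr_wpDl// mul1r lerDl //.
have uW : 0 <= u * W by rewrite mulr_ge0.
lra.
Qed.

(** For T > 0 the value is sqrt T times the normalized value at sqrt T, so continuity follows from
    that of f. *)
Lemma value_continuous (T : R) : 0 < T ->
  fine (V x c) @[x --> T] --> fine (V T c).
Proof.
move=> T0.
have VE x : 0 < x -> fine (V x c) = Num.sqrt x * f (Num.sqrt x).
  by move=> x0; rewrite /f mulrA mulfV ?gt_eqF ?sqrtr_gt0// mul1r sqr_sqrtr// ltW.
rewrite (VE T T0).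
apply: (@cvg_trans _ ((Num.sqrt x * f (Num.sqrt x)) @[x --> T])).
  apply: near_eq_cvg; near=> x; rewrite VE//; near: x; exact: lt_nbhsr.
have cs : Num.sqrt x @[x --> T] --> Num.sqrt T by exact: sqrt_continuous.
have sT0 : 0 < Num.sqrt T by rewrite sqrtr_gt0.
have cf : f y @[y --> Num.sqrt T] --> f (Num.sqrt T).
  exact: (nonincreasing_convex_continuous normalized_value_ge0
    normalized_value_nincr normalized_value_conv sT0).
have cfs : f (Num.sqrt x) @[x --> T] --> f (Num.sqrt T) by exact: cvg_comp cs cf.
exact: cvgM cs cfs.
Unshelve. all: end_near. Qed.

End normalized_value.

Unset Implicit Arguments.

(** Each horizon carries its own probability space and Brownian motion, with no relation assumed
    between them. The finiteness clause ensures that [fine] loses nothing on positive horizons. *)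
Theorem proposition2p8 (R : realType) (d : R -> measure_display)
    (Omega : forall T : R, measurableType (d T))
    (P : forall T : R, probability (Omega T) R)
    (B : forall T : R, R -> Omega T -> R)
    (HB : forall T : R, 0 < T -> brownian_motion (P T) T (B T)) :
  let V := fun T : R => Vinfty (P T) (B T) T in
  let f := fun r : R => r^-1 * fine (V (r ^+ 2)) in
  [/\ forall T : R, 0 < T -> V T \is a fin_num,
      {in `]0, +oo[ &, forall r s : R, r <= s -> f s <= f r},
      convex_function (`]0, +oo[%classic : set R) f &
      {in `]0, +oo[, continuous (fun T : R => fine (V T))}].
Proof.
move=> V f.
have c0 : 0 < Num.sqrt (2 / pi) :> R by rewrite sqrtr_gt0 divr_gt0// pi_gt0.
split.
- by move=> T T0; exact: (value_fin_num T0 (HB T T0) c0).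
- move=> r s; rewrite !in_itv /= !andbT => r0 _ rs.
  exact: (normalized_value_nincr HB c0 r0 rs).
- move=> t x y /[!inE] /= /[!in_itv] /= /[!andbT] x0 y0.
  rewrite convRE [X in f X]convRE.
  exact: (normalized_value_conv HB c0 _ _ x0 y0).
- move=> T; rewrite in_itv /= andbT => T0.
  exact: (value_continuous HB c0 T0).
Qed.
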